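(* Let $\mathscr{T}$ be a triangulated category, let $\mathscr{A}$ be an abelian category equipped with an auto-equivalence $x\mapsto x[1]$, such that for all objects $x,y$ of $\mathscr{A}$ the equivalence classes of extensions of $x$ by $y$ form a set $\mathrm{Ext}^1_{\mathscr{A}}(x,y)$. Let $h:\mathscr{T}\to\mathscr{A}$ be a homology theory. Assume the following conditions hold: (i) $h$ reflects isomorphisms; (ii) $h$ is full. Then the ideal $\mathbb{I}$ of $\mathscr{T}$ given by $$\mathbb{I}(X,Y)=\{f\in \mathrm{Hom}_{\mathscr{T}}(X,Y)\mid h(f)=0\}$$ is a square zero ideal, i.e. $gf=0$ whenever $f\in\mathbb{I}(X,Y)$ and $g\in\mathbb{I}(Y,Z)$. Suppose additionally that the following condition holds: (iii) for any short exact sequence $0\to x\to y\to z\to 0$ in $\mathscr{A}$ with $x\cong h(X)$ and $z\cong h(Z)$ for some objects $X,Z$ of $\mathscr{T}$, there is an object $Y\in\mathscr{T}$ and an isomorphism $h(Y)\cong y$ in $\mathscr{A}$. Then $\mathbb{I}$ is isomorphic, as a bifunctor on $\mathscr{T}$, to $$(X,Y)\mapsto \mathrm{Ext}^1_{\mathscr{A}}(h(X)[1],h(Y)).$$ In particular, for any $X,Y\in\mathscr{T}$ one has a short exact sequence $$0\to \mathrm{Ext}^1_{\mathscr{A}}(h(X)[1],h(Y))\to \mathrm{Hom}_{\mathscr{T}}(X,Y)\to \mathrm{Hom}_{\mathscr{A}}(h(X),h(Y))\to 0,$$ in which the second map is $f\mapsto h(f)$. Moreover, if condition (iii) is replaced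 by the stronger condition (iv) for any object $x\in\mathscr{A}$ there is an object $X\in\mathscr{T}$ and an isomorphism $h(X)\cong x$ in $\mathscr{A}$, then $\mathscr{A}$ is a hereditary abelian category and all idempotents in $\mathscr{T}$ split.
   Context: Triangulated categories are understood in the sense of Puppe: the octahedral axiom is not assumed. The shift of an object $X$ of $\mathscr{T}$ is denoted $X[1]$. A homology theory on $\mathscr{T}$ with values in $\mathscr{A}$ is a functor $h:\mathscr{T}\to\mathscr{A}$ that commutes with shifting up to natural isomorphism ($h(X[1])\cong h(X)[1]$) and such that for any distinguished triangle $X\to Y\to Z\to X[1]$ in $\mathscr{T}$ the induced sequence $h(X)\to h(Y)\to h(Z)$ is exact. Consequently there is a long exact sequence $\cdots\to h(Z)[-1]\to h(X)\to h(Y)\to h(Z)\to h(X)[1]\to\cdots$. The functor $h$ reflects isomorphisms if a morphism $f$ of $\mathscr{T}$ is an isomorphism whenever $h(f)$ is an isomorphism. It is full if $\mathrm{Hom}_{\mathscr{T}}(X,Y)\to\mathrm{Hom}_{\mathscr{A}}(h(X),h(Y))$, $f\mapsto h(f)$, is surjective for all $X,Y\in\mathscr{T}$. An ideal in an additive category $\mathbb{A}$ is a sub-bifunctor of $\mathrm{Hom}_{\mathbb{A}}(-,-):\mathbb{A}^{op}\times\mathbb{A}\to \mathrm{Ab}$, where $\mathrm{Ab}$ is the category of abelian groups. Bifunctors on $\mathscr{T}$ here are functors $\mathscr{T}^{op}\times\mathscr{T}\to\mathrm{Ab}$. $\mathrm{Ext}$ is understood in the sense of Yoneda: $\mathrm{Ext}^1_{\mathscr{A}}(x,y)$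 is the set of equivalence classes of short exact sequences $0\to y\to z\to x\to 0$, with the Baer sum. An abelian category $\mathscr{A}$ is hereditary if for any exact sequence $0\to u\xrightarrow{a} v\xrightarrow{b} w\xrightarrow{c} x\to 0$ in $\mathscr{A}$ there exist a short exact sequence $0\to v\xrightarrow{i} z\xrightarrow{p} x\to 0$ and a morphism $q:z\to w$ with $qi=b$ and $cq=p$; equivalently, $\mathrm{Ext}^2_{\mathscr{A}}=0$ (Yoneda Ext). *)

(* Defs.v *)
(* Hom-sets and Ext-sets are zmodTypes; under the classical axioms of boolp any
   abelian group carries such a structure. *)
From HB Require Import structures.
From mathcomp Require Import all_boot ssralg.
From mathcomp Require Import boolp.

Set Implicit Arguments.
Unset Strict Implicit.
Unset Printing Implicit Defensive.

Import GRing.Theory.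
Local Open Scope ring_scope.

Reserved Notation "g \c f" (at level 40, left associativity).

Record preadditive := Preadditive {
  obj :> Type;
  hom : obj -> obj -> zmodType;
  idm : forall X, hom X X;
  comp : forall X Y Z, hom Y Z -> hom X Y -> hom X Z;
  compA : forall W X Y Z (h : hom Y Z) (g : hom X Y) (f : hom W X),
    comp h (comp g f) = comp (comp h g) f;
  comp1m : forall X Y (f : hom X Y), comp (idm Y) f = f;
  compm1 : forall X Y (f : hom X Y), comp f (idm X) = f;
  compDl : forall X Y Z (g g' : hom Y Z) (f : hom X Y),
    comp (g + g') f = comp g f + comp g' f;
  compDr : forall X Y Z (g : hom Y Z) (f f' : hom X Y),
    comp g (f + f') = comp g f + comp g f' }.

Arguments hom {p} _ _.
Arguments idm {p} _.
Notation "g \c f" := (comp g f).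

Section Morphisms.
Variable C : preadditive.
Implicit Types X Y Z K : C.

Definition is_zero_obj (Z : C) : Prop :=
  (forall X (f : hom X Z), f = 0) /\ (forall X (f : hom Z X), f = 0).

Definition isom X Y (f : hom X Y) : Prop :=
  exists g : hom Y X, g \c f = idm X /\ f \c g = idm Y.

Definition isomorphic X Y : Prop := exists f : hom X Y, isom f.

Definition mono X Y (f : hom X Y) : Prop :=
  forall W (s t : hom W X), f \c s = f \c t -> s = t.

Definition epi X Y (f : hom X Y) : Prop :=
  forall W (s t : hom Y W), s \c f = t \c f -> s = t.

Definition is_kernel K X Y (k : hom K X) (f : hom X Y) : Prop :=
  f \c k = 0 /\
  forall W (t : hom W X), f \c t = 0 -> exists! s : hom W K, k \c s = t.

Definition is_cokernel X Y Q (q : hom Y Q) (f : hom X Y) : Prop :=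
  q \c f = 0 /\
  forall W (t : hom Y W), t \c f = 0 -> exists! s : hom Q W, s \c q = t.

(* The image of f is the kernel of its cokernel. *)
Definition is_image J X Y (j : hom J Y) (f : hom X Y) : Prop :=
  exists Q (q : hom Y Q), is_cokernel q f /\ is_kernel j q.

Definition exact X Y Z (f : hom X Y) (g : hom Y Z) : Prop :=
  exists J (j : hom J Y), is_image j f /\ is_kernel j g.

Definition short_exact X Y Z (i : hom X Y) (p : hom Y Z) : Prop :=
  [/\ mono i, exact i p & epi p].

End Morphisms.

Record functor (C D : preadditive) := Functor {
  fobj :> C -> D;
  fmap : forall X Y, hom X Y -> hom (fobj X) (fobj Y);
  fmap1 : forall X, fmap (idm X) = idm (fobj X);
  fmapM : forall X Y Z (g : hom Y Z) (f : hom X Y),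
    fmap (g \c f) = fmap g \c fmap f }.

Arguments fmap {C D} _ {X Y} _.

Definition id_functor (C : preadditive) : functor C C.
Proof. by exists id (fun X Y f => f). Defined.

Definition comp_functor (C D E : preadditive) (G : functor D E)
  (F : functor C D) : functor C E.
Proof.
exists (fun X => G (F X)) (fun X Y f => fmap G (fmap F f)).
- by move=> X; rewrite !fmap1.
- by move=> X Y Z g f; rewrite !fmapM.
Defined.

Definition nat_isomorphic (C D : preadditive) (F G : functor C D) : Prop :=
  exists a : forall X, hom (F X) (G X),
    (forall X, isom (a X)) /\
    (forall X Y (f : hom X Y), a Y \c fmap F f = fmap G f \c a X).

Definition is_equivalence (C D : preadditive) (F : functor C D) : Prop :=
  exists G : functor D C,
    nat_isomorphic (comp_functor G F) (id_functor C) /\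
    nat_isomorphic (comp_functor F G) (id_functor D).

Record auto_equivalence (C : preadditive) := AutoEquivalence {
  ae_functor :> functor C C;
  ae_equiv : is_equivalence ae_functor }.

Definition reflects_isos (C D : preadditive) (F : functor C D) : Prop :=
  forall X Y (f : hom X Y), isom (fmap F f) -> isom f.

Definition full (C D : preadditive) (F : functor C D) : Prop :=
  forall X Y (g : hom (F X) (F Y)), exists f : hom X Y, fmap F f = g.

Definition idempotents_split (C : preadditive) : Prop :=
  forall (X : C) (e : hom X X), e \c e = e ->
  exists (Y : C) (i : hom Y X) (p : hom X Y), p \c i = idm Y /\ i \c p = e.

Record additive := Additive {
  add_cat :> preadditive;
  zero_obj : add_cat;
  zero_objP : is_zero_obj zero_obj;
  bip : add_cat -> add_cat -> add_cat;
  bi1 : forall X Y, hom X (bip X Y);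
  bi2 : forall X Y, hom Y (bip X Y);
  bp1 : forall X Y, hom (bip X Y) X;
  bp2 : forall X Y, hom (bip X Y) Y;
  bp1i1 : forall X Y, bp1 X Y \c bi1 X Y = idm X;
  bp2i2 : forall X Y, bp2 X Y \c bi2 X Y = idm Y;
  bp1i2 : forall X Y, bp1 X Y \c bi2 X Y = 0;
  bp2i1 : forall X Y, bp2 X Y \c bi1 X Y = 0;
  bipE : forall X Y, bi1 X Y \c bp1 X Y + bi2 X Y \c bp2 X Y = idm (bip X Y) }.

Record abelian := Abelian {
  ab_cat :> additive;
  ab_kernel : forall (X Y : ab_cat) (f : hom X Y),
    exists K (k : hom K X), is_kernel k f;
  ab_cokernel : forall (X Y : ab_cat) (f : hom X Y),
    exists Q (q : hom Y Q), is_cokernel q f;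
  ab_mono_kernel : forall (X Y : ab_cat) (f : hom X Y), mono f ->
    exists Z (g : hom Y Z), is_kernel f g;
  ab_epi_cokernel : forall (X Y : ab_cat) (f : hom X Y), epi f ->
    exists W (g : hom W X), is_cokernel f g }.

(* Puppe's axioms: no octahedral axiom.  The shift is an auto-equivalence,
   not necessarily a strict automorphism. *)
Record triangulated := Triangulated {
  tr_cat :> additive;
  shift : auto_equivalence tr_cat;
  dist : forall X Y Z : tr_cat,
    hom X Y -> hom Y Z -> hom Z (shift X) -> Prop;
  dist_isom : forall (X Y Z X' Y' Z' : tr_cat)
      (f : hom X Y) (g : hom Y Z) (d : hom Z (shift X))
      (f' : hom X' Y') (g' : hom Y' Z') (d' : hom Z' (shift X'))
      (u : hom X X') (v : hom Y Y') (w : hom Z Z'),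
    isom u -> isom v -> isom w ->
    v \c f = f' \c u -> w \c g = g' \c v -> fmap shift u \c d = d' \c w ->
    dist f g d -> dist f' g' d';
  dist_id : forall X : tr_cat,
    dist (idm X) (0 : hom X (zero_obj tr_cat)) 0;
  dist_cone : forall (X Y : tr_cat) (f : hom X Y),
    exists Z (g : hom Y Z) (d : hom Z (shift X)), dist f g d;
  dist_rot : forall (X Y Z : tr_cat)
      (f : hom X Y) (g : hom Y Z) (d : hom Z (shift X)),
    dist f g d <-> dist g d (- fmap shift f);
  dist_mor : forall (X Y Z X' Y' Z' : tr_cat)
      (f : hom X Y) (g : hom Y Z) (d : hom Z (shift X))
      (f' : hom X' Y') (g' : hom Y' Z') (d' : hom Z' (shift X'))
      (u : hom X X') (v : hom Y Y'),
    dist f g d -> dist f' g' d' -> v \c f = f' \c u ->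
    exists w : hom Z Z', w \c g = g' \c v /\ d' \c w = fmap shift u \c d }.

Definition hereditary (A : abelian) : Prop :=
  forall (u v w x : A) (a : hom u v) (b : hom v w) (c : hom w x),
    mono a -> exact a b -> exact b c -> epi c ->
  exists (z : A) (i : hom v z) (p : hom z x) (q : hom z w),
    [/\ short_exact i p, q \c i = b & c \c q = p].

(* Additivity of the functor is a consequence: see homology_additive. *)
Record homology_theory (T : triangulated) (A : abelian) (s : auto_equivalence A) :=
  Homology {
  hfun :> functor T A;
  hom_shift : nat_isomorphic (comp_functor hfun (shift T)) (comp_functor s hfun);
  hom_exact : forall (X Y Z : T) (f : hom X Y) (g : hom Y Z)
      (d : hom Z (shift T X)),
    dist f g d -> exact (fmap hfun f) (fmap hfun g) }.

Definition realizes_extensions (C : preadditive) (A : abelian)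
    (h : functor C A) : Prop :=
  forall (x y z : A) (i : hom x y) (p : hom y z) (X Z : C),
    short_exact i p -> isomorphic x (h X) -> isomorphic z (h Z) ->
  exists Y : C, isomorphic (h Y) y.

Definition realizes_objects (C : preadditive) (A : abelian)
    (h : functor C A) : Prop :=
  forall x : A, exists X : C, isomorphic (h X) x.

Record ideal (C : preadditive) := Ideal {
  ideal_pred :> forall X Y : C, {pred hom X Y};
  ideal_zmod : forall X Y, zmod_closed (@ideal_pred X Y);
  ideal_compl : forall X Y Z (g : hom Y Z) (f : hom X Y),
    f \in @ideal_pred X Y -> g \c f \in @ideal_pred X Z;
  ideal_compr : forall X Y Z (g : hom Y Z) (f : hom X Y),
    g \in @ideal_pred Y Z -> g \c f \in @ideal_pred X Z }.

Arguments ideal_pred {C} _ _ _.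

Definition square_zero (C : preadditive) (I : ideal C) : Prop :=
  forall (X Y Z : C) (f : hom X Y) (g : hom Y Z),
    f \in I X Y -> g \in I Y Z -> g \c f = 0.

(* A functor C^op x C -> Ab. *)
Record bifunctor (C : preadditive) := Bifunctor {
  bobj :> C -> C -> zmodType;
  bmap : forall X' X Y Y' : C,
    hom X' X -> hom Y Y' -> {additive bobj X Y -> bobj X' Y'};
  bmap1 : forall X Y (e : bobj X Y), bmap (idm X) (idm Y) e = e;
  bmapM : forall X'' X' X Y Y' Y'' (f' : hom X'' X') (f : hom X' X)
      (g : hom Y Y') (g' : hom Y' Y'') (e : bobj X Y),
    bmap (f \c f') (g' \c g) e = bmap f' g' (bmap f g e) }.

Arguments bmap {C} _ {X' X Y Y'} _ _.

Record bifunctor_iso (C : preadditive) (B B' : bifunctor C) := BifunctorIso {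
  biso :> forall X Y, {additive B X Y -> B' X Y};
  biso_bij : forall X Y, bijective (biso X Y);
  biso_nat : forall X' X Y Y' (f : hom X' X) (g : hom Y Y') (e : B X Y),
    biso X' Y' (bmap B f g e) = bmap B' f g (biso X Y e) }.

Definition ab_short_exact (U V W : zmodType) (f : {additive U -> V})
    (g : {additive V -> W}) : Prop :=
  [/\ injective f,
      forall v, g v = 0 <-> exists u, f u = v
    & forall w, exists v, g v = w].

Section PreadditiveFacts.
Variable C : preadditive.
Implicit Types X Y Z : C.

Lemma comp0m X Y Z (f : hom X Y) : (0 : hom Y Z) \c f = 0.
Proof. by apply: (addIr (0 \c f)); rewrite -compDl !add0r. Qed.

Lemma compm0 X Y Z (g : hom Y Z) : g \c (0 : hom X Y) = 0.
Proof. by apply: (addIr (g \c 0)); rewrite -compDr !add0r. Qed.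

Lemma compNm X Y Z (g : hom Y Z) (f : hom X Y) : (- g) \c f = - (g \c f).
Proof. by apply: (addIr (g \c f)); rewrite -compDl !addNr comp0m. Qed.

Lemma compmN X Y Z (g : hom Y Z) (f : hom X Y) : g \c (- f) = - (g \c f).
Proof. by apply: (addIr (g \c f)); rewrite -compDr !addNr compm0. Qed.

Lemma compBl X Y Z (g g' : hom Y Z) (f : hom X Y) :
  (g - g') \c f = g \c f - g' \c f.
Proof. by rewrite compDl compNm. Qed.

Lemma compBr X Y Z (g : hom Y Z) (f f' : hom X Y) :
  g \c (f - f') = g \c f - g \c f'.
Proof. by rewrite compDr compmN. Qed.

Lemma monoP X Y (f : hom X Y) :
  (forall W (s : hom W X), f \c s = 0 -> s = 0) -> mono f.
Proof.
move=> H W s t e; apply/subr0_eq/H.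
by rewrite compBr e subrr.
Qed.

Lemma epiP X Y (f : hom X Y) :
  (forall W (s : hom Y W), s \c f = 0 -> s = 0) -> epi f.
Proof.
move=> H W s t e; apply/subr0_eq/H.
by rewrite compBl e subrr.
Qed.

Lemma mono0 X Y (f : hom X Y) W (s : hom W X) : mono f -> f \c s = 0 -> s = 0.
Proof. by move=> mf e; apply: mf; rewrite e compm0. Qed.

Lemma epi0 X Y (f : hom X Y) W (s : hom Y W) : epi f -> s \c f = 0 -> s = 0.
Proof. by move=> ef e; apply: ef; rewrite e comp0m. Qed.

Lemma kernel_mono K X Y (k : hom K X) (f : hom X Y) : is_kernel k f -> mono k.
Proof.
move=> [fk H] W s t e.
have [|r [_ ru]] := H W (k \c s); first by rewrite compA fk comp0m.
by rewrite -(ru s) // -(ru t).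
Qed.

Lemma cokernel_epi X Y Q (q : hom Y Q) (f : hom X Y) : is_cokernel q f -> epi q.
Proof.
move=> [fk H] W s t e.
have [|r [_ ru]] := H W (s \c q); first by rewrite -compA fk compm0.
by rewrite -(ru s) // -(ru t).
Qed.

Lemma kernelP K X Y (k : hom K X) (f : hom X Y) : mono k -> f \c k = 0 ->
  (forall W (t : hom W X), f \c t = 0 -> exists s : hom W K, k \c s = t) ->
  is_kernel k f.
Proof.
move=> mk fk H; split=> // W t /H[s es]; exists s; split=> // s' es'.
by apply: mk; rewrite es.
Qed.

Lemma cokernelP X Y Q (q : hom Y Q) (f : hom X Y) : epi q -> q \c f = 0 ->
  (forall W (t : hom Y W), t \c f = 0 -> exists s : hom Q W, s \c q = t) ->
  is_cokernel q f.
Proof.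
move=> mk fk H; split=> // W t /H[s es]; exists s; split=> // s' es'.
by apply: mk; rewrite es.
Qed.

End PreadditiveFacts.

Section IdealBifunctor.
Variables (C : preadditive) (I : ideal C).

HB.instance Definition _ X Y :=
  GRing.isZmodClosed.Build (hom X Y) (I X Y) (@ideal_zmod C I X Y).

Definition ideal_hom (X Y : C) := {f : hom X Y | f \in I X Y}.
HB.instance Definition _ X Y := SubChoice.on (ideal_hom X Y).
HB.instance Definition _ X Y :=
  [SubChoice_isSubZmodule of ideal_hom X Y by <:].

Definition ideal_act X' X Y Y' (f : hom X' X) (g : hom Y Y')
    (e : ideal_hom X Y) : ideal_hom X' Y' :=
  exist _ (g \c val e \c f) (ideal_compr f (ideal_compl g (valP e))).

Lemma ideal_act_additive X' X Y Y' (f : hom X' X) (g : hom Y Y') :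
  zmod_morphism (ideal_act f g).
Proof. by move=> a b; apply/val_inj; rewrite /= compBr compBl. Qed.

HB.instance Definition _ X' X Y Y' (f : hom X' X) (g : hom Y Y') :=
  GRing.isZmodMorphism.Build (ideal_hom X Y) (ideal_hom X' Y')
    (ideal_act f g) (ideal_act_additive f g).

Definition ideal_bifunctor : bifunctor C.
Proof.
exists (fun X Y => ideal_hom X Y : zmodType)
       (fun X' X Y Y' f g => ideal_act f g : {additive _ -> _}).
- by move=> X Y e; apply/val_inj; rewrite /= comp1m compm1.
- by move=> *; apply/val_inj; rewrite /= !compA.
Defined.

End IdealBifunctor.


Section AbelianFacts.
Variable A : abelian.
Implicit Types x y z : A.

Lemma exact_comp0 x y z (f : hom x y) (g : hom y z) : exact f g -> g \c f = 0.
Proof.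
move=> [J [j [[Q [q [[qf _] [_ Hj]]]] [gj _]]]].
by have [t [<- _]] := Hj _ _ qf; rewrite compA gj comp0m.
Qed.

Lemma mono_kernel_cokernel x y q (f : hom x y) (c : hom y q) :
  mono f -> is_cokernel c f -> is_kernel f c.
Proof.
move=> mf [cf Hc]; have [z [g [gf Hg]]] := ab_mono_kernel mf.
apply: kernelP => // w t ct.
have [r [rc _]] := Hc _ _ gf.
have [|s [es _]] := Hg w t; first by rewrite -rc -compA ct compm0.
by exists s.
Qed.

Lemma epi_cokernel_kernel k x y (f : hom x y) (c : hom k x) :
  epi f -> is_kernel c f -> is_cokernel f c.
Proof.
move=> mf [cf Hc]; have [z [g [gf Hg]]] := ab_epi_cokernel mf.
apply: cokernelP => // w t ct.
have [r [rc _]] := Hc _ _ gf.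
have [|s [es _]] := Hg w t; first by rewrite -rc compA ct comp0m.
by exists s.
Qed.

Lemma exact_mono_kernel x y z (f : hom x y) (g : hom y z) :
  mono f -> exact f g -> is_kernel f g.
Proof.
move=> mf fg; apply: kernelP (exact_comp0 fg) _ => // w t gt.
have [J [j [[Q [q [qf [qj _]]]] [_ Hj]]]] := fg.
have [s [<- _]] := Hj _ _ gt.
have [_ Hf] := mono_kernel_cokernel mf qf.
have [|r [er _]] := Hf _ (j \c s); first by rewrite compA qj comp0m.
by exists r.
Qed.

Lemma short_exactP x y z (i : hom x y) (p : hom y z) :
  short_exact i p <-> is_kernel i p /\ is_cokernel p i.
Proof.
split=> [[mi ip ep]|[ki cp]].
  have ki := exact_mono_kernel mi ip.
  by split=> //; apply: epi_cokernel_kernel.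
split; [exact: kernel_mono ki| |exact: cokernel_epi cp].
by exists x, i; split=> //; exists z, p.
Qed.

Lemma mono_epi_isom x y (m : hom x y) : mono m -> epi m -> isom m.
Proof.
move=> mm em; have [z [c [cm Hc]]] := ab_mono_kernel mm.
have [|s [ms _]] := Hc _ (idm y).
  by rewrite compm1; apply: (epi0 em).
exists s; split=> //; apply: mm.
by rewrite compA ms comp1m compm1.
Qed.

End AbelianFacts.

Section KernelIdeal.
Variables (T : triangulated) (A : abelian) (s : auto_equivalence A).
Variable h : homology_theory T s.

Lemma dist_comp0 (X Y Z : T) (f : hom X Y) (g : hom Y Z)
  (d : hom Z (shift T X)) : dist f g d -> g \c f = 0.
Proof.
move=> D; have [] := dist_mor (u := idm X) (v := f) (dist_id X) D.
  by rewrite !compm1.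
by move=> w [<- _]; rewrite compm0.
Qed.

Lemma homology_map0 (X Y : T) : fmap h (0 : hom X Y) = 0.
Proof.
set Z := zero_obj T.
have zZ : idm (h Z) = 0.
  have := exact_comp0 (hom_exact h (dist_id Z)).
  have [H0 _] := zero_objP T.
  by rewrite -(H0 _ (idm Z)) fmap1 comp1m.
rewrite -(comp0m Y (0 : hom X Z)) fmapM.
by rewrite -(comp1m (fmap h (0 : hom X Z))) zZ comp0m compm0.
Qed.

Lemma homology_bip (X Y : T) :
  fmap h (bi1 X Y) \c fmap h (bp1 X Y) + fmap h (bi2 X Y) \c fmap h (bp2 X Y)
  = idm (h (bip X Y)).
Proof.
have [C [r [d D]]] := dist_cone (bi1 X Y).
have ri := dist_comp0 D.
have pi : fmap h (bp1 X Y) \c fmap h (bi1 X Y) = idm (h X).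
  by rewrite -fmapM bp1i1 fmap1.
have mi : mono (fmap h (bi1 X Y)).
  by apply: monoP => W t /(congr1 (comp (fmap h (bp1 X Y))));
     rewrite compA pi comp1m compm0.
have [_ K] := exact_mono_kernel mi (hom_exact h D).
apply/esym/subr0_eq; set k := (X in X = 0).
have rE : r = r \c bi2 X Y \c bp2 X Y.
  by rewrite -{1}[r]compm1 -bipE compDr compA ri comp0m add0r compA.
have [|t [kE _]] := K _ k.
  rewrite /k compBr compm1 compDr -!fmapM !compA ri comp0m homology_map0 add0r.
  by rewrite -rE subrr.
rewrite -kE; suff -> : t = 0 by rewrite compm0.
rewrite -[t]comp1m -pi -compA kE /k compBr compm1 compDr !compA pi comp1m.
have -> : fmap h (bp1 X Y) \c fmap h (bi2 X Y) = 0.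
  by rewrite -fmapM bp1i2 homology_map0.
by rewrite comp0m addr0 subrr.
Qed.

Lemma homology_additive (X Y : T) : zmod_morphism (@fmap _ _ h X Y).
Proof.
have hD (f g : hom X Y) : fmap h (f + g) = fmap h f + fmap h g.
  pose D := bi1 Y Y \c f + bi2 Y Y \c g.
  pose S := bp1 Y Y + bp2 Y Y.
  have pD : bp1 Y Y \c D = f.
    by rewrite compDr !compA bp1i1 bp1i2 comp1m comp0m addr0.
  have qD : bp2 Y Y \c D = g.
    by rewrite compDr !compA bp2i2 bp2i1 comp1m comp0m add0r.
  have Si : S \c bi1 Y Y = idm Y by rewrite compDl bp1i1 bp2i1 addr0.
  have Sj : S \c bi2 Y Y = idm Y by rewrite compDl bp2i2 bp1i2 add0r.
  have -> : f + g = S \c D by rewrite -{1}pD -{1}qD -compDl.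
  rewrite fmapM -{1}[fmap h S]compm1 -homology_bip compDr compDl !compA.
  by rewrite -!fmapM Si Sj !comp1m pD qD.
by move=> f g; apply: (addIr (fmap h g)); rewrite -hD !subrK.
Qed.

HB.instance Definition _ (X Y : T) :=
  GRing.isZmodMorphism.Build (hom X Y) (hom (h X) (h Y)) (@fmap _ _ h X Y)
    (@homology_additive X Y).

Definition ker_ideal : ideal T.
Proof.
exists (fun X Y (f : hom X Y) => fmap h f == 0).
- move=> X Y; split=> [|f g]; rewrite !unfold_in ?homology_map0 //.
  by rewrite homology_additive => /eqP-> /eqP->; rewrite subrr.
- by move=> X Y Z g f; rewrite !unfold_in fmapM => /eqP->; rewrite compm0.
- by move=> X Y Z g f; rewrite !unfold_in fmapM => /eqP->; rewrite comp0m.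
Defined.

End KernelIdeal.

Record extension (A : abelian) (x y : A) := Extension {
  ext_mid : A;
  ext_inj : hom y ext_mid;
  ext_proj : hom ext_mid x;
  ext_exact : short_exact ext_inj ext_proj }.

(* There is a morphism of short exact sequences from e to e' with g on the left
   and f on the right. *)
Definition ext_mor (A : abelian) (x y x' y' : A) (g : hom y y') (f : hom x x')
    (e : extension x y) (e' : extension x' y') : Prop :=
  exists m : hom (ext_mid e) (ext_mid e'),
    m \c ext_inj e = ext_inj e' \c g /\ ext_proj e' \c m = f \c ext_proj e.

(* By the five lemma (ext_five) the middle map is then an isomorphism. *)
Definition ext_equiv (A : abelian) (x y : A) (e e' : extension x y) : Prop :=
  ext_mor (idm y) (idm x) e e'.

(* Equivalence classes of extensions form a set: extension x y lives in the
   universe of the objects of A, whereas Ext1 x y lives in that of its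
   hom-sets.  Quotients by ext_equiv are unique up to unique bijection, so
   nothing depends on the chosen one. *)
Record ext_sets (A : abelian) := ExtSets {
  Ext1 :> A -> A -> Type;
  ext_class : forall x y, extension x y -> Ext1 x y;
  ext_class_surj : forall x y (c : Ext1 x y), exists e, ext_class e = c;
  ext_classP : forall x y (e e' : extension x y),
    ext_class e = ext_class e' <-> ext_equiv e e' }.

Arguments ext_class {A} _ {x y} _.

Section ExtensionFacts.
Variable A : abelian.
Implicit Types x y z : A.

Lemma ext_mor_comp x y x' y' x'' y'' (g : hom y y') (f : hom x x')
    (g' : hom y' y'') (f' : hom x' x'') (e : extension x y)
    (e' : extension x' y') (e'' : extension x'' y'') :
  ext_mor g f e e' -> ext_mor g' f' e' e'' -> ext_mor (g' \c g) (f' \c f) e e''.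
Proof.
move=> [m [mi pm]] [n [ni pn]]; exists (n \c m); split.
  by rewrite -compA mi compA ni compA.
by rewrite compA pn -compA pm compA.
Qed.

Lemma ext_equiv_refl x y (e : extension x y) : ext_equiv e e.
Proof. by exists (idm _); rewrite !comp1m !compm1. Qed.

Lemma ext_five x y (e e' : extension x y) (m : hom (ext_mid e) (ext_mid e')) :
  m \c ext_inj e = ext_inj e' -> ext_proj e' \c m = ext_proj e -> isom m.
Proof.
move=> mi pm.
have [mj' _ ep'] := ext_exact e'.
have [[_ K] [_ Q]] := (short_exactP _ _).1 (ext_exact e).
have [[pi' K'] [_ Q']] := (short_exactP _ _).1 (ext_exact e').
apply: mono_epi_isom.
  apply: monoP => w t mt.
  have [|s [ts _]] := K _ t; first by rewrite -pm -compA mt compm0.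
  move: mt; rewrite -ts compA mi => /(mono0 mj') ->.
  by rewrite compm0.
apply: epiP => w t tm.
have [|s [ts _]] := Q' _ t; first by rewrite -mi compA tm comp0m.
move: tm; rewrite -ts -compA pm => sp.
have [_ _ ep] := ext_exact e.
by rewrite (epi0 ep sp) comp0m.
Qed.

Lemma ext_equiv_sym x y (e e' : extension x y) : ext_equiv e e' -> ext_equiv e' e.
Proof.
move=> [m]; rewrite compm1 comp1m => -[mi pm].
have [n [nm mn]] := ext_five mi pm.
exists n; rewrite compm1 comp1m; split.
  by rewrite -mi compA nm comp1m.
by rewrite -pm -compA mn compm1.
Qed.

Lemma ext_equiv_trans x y (e e' e'' : extension x y) :
  ext_equiv e e' -> ext_equiv e' e'' -> ext_equiv e e''.
Proof. by move=> a b; have := ext_mor_comp a b; rewrite !comp1m. Qed.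

(* The pushout of an extension along g, with its universal property. *)
Lemma ext_pushout x y y' (g : hom y y') (e : extension x y) :
  exists e' : extension x y', ext_mor g (idm x) e e' /\
    forall x'' y'' (n : hom y' y'') (f : hom x x'') (e'' : extension x'' y''),
      ext_mor (n \c g) f e e'' -> ext_mor n f e' e''.
Proof.
case: e => z i p ip; have [mi _ ep] := ip.
have [[pi K] [_ Q]] := (short_exactP _ _).1 ip.
pose d := bi1 z y' \c i - bi2 z y' \c g.
have p1d : bp1 z y' \c d = i.
  by rewrite compBr !compA bp1i1 bp1i2 comp1m comp0m subr0.
have md : mono d.
  by apply: monoP => w t dt; apply: (mono0 mi); rewrite -p1d -compA dt compm0.
have [P [q qc]] := ab_cokernel d.
have [_ Kd] := mono_kernel_cokernel md qc.
have eq_ := cokernel_epi qc; have [qd Hq] := qc.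
have sq : q \c bi1 z y' \c i = q \c bi2 z y' \c g.
  by apply: subr0_eq; rewrite -!compA -compBr.
have [|p' [p'q _]] := Hq _ (p \c bp1 z y'); first by rewrite -compA p1d.
have p'm : p' \c (q \c bi1 z y') = p.
  by rewrite compA p'q -compA bp1i1 compm1.
have p'i : p' \c (q \c bi2 z y') = 0.
  by rewrite compA p'q -compA bp1i2 compm0.
have qE w (t t' : hom P w) : t \c (q \c bi1 z y') = t' \c (q \c bi1 z y') ->
    t \c (q \c bi2 z y') = t' \c (q \c bi2 z y') -> t = t'.
  move=> e1 e2; apply: eq_; rewrite -[t \c q]compm1 -[t' \c q]compm1 -!bipE.
  by rewrite !compDr !compA -(compA t) -(compA t q (bi2 _ _)) e1 e2 !compA.
have ip' : short_exact (q \c bi2 z y') p'.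
  apply/short_exactP.
  have ep' : epi p'.
    apply: epiP => w t tp; apply: (epi0 ep).
    by rewrite -p'm compA tp comp0m.
  have mi' : mono (q \c bi2 z y').
    apply: monoP => w t; rewrite -compA => /Kd[r [dr _]].
    have r0 : r = 0.
      by apply: (mono0 mi); rewrite -p1d -compA dr compA bp1i2 comp0m.
    by rewrite -[t]comp1m -(bp2i2 z y') -compA -dr r0 !compm0.
  have cp' : is_cokernel p' (q \c bi2 z y').
    apply: cokernelP => // w t ti.
    have [|s [sp _]] := Q _ (t \c (q \c bi1 z y')).
      by rewrite -compA sq compA ti comp0m.
    exists s; apply: qE; first by rewrite -compA p'm.
    by rewrite -compA p'i compm0 ti.
  by split=> //; apply: mono_kernel_cokernel.
exists (Extension ip'); split.
  by exists (q \c bi1 z y') => /=; rewrite comp1m.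
move=> x'' y'' n f e'' [m /= [mi' pm]].
have [|t [tq _]] := Hq _ (m \c bp1 z y' + ext_inj e'' \c n \c bp2 z y').
  have p2d : bp2 z y' \c d = - g.
    by rewrite compBr !compA bp2i1 bp2i2 comp0m comp1m sub0r.
  by rewrite compDl -!compA p1d p2d mi' !compmN subrr.
have [[pi'' _] _] := (short_exactP _ _).1 (ext_exact e'').
have t1 : t \c (q \c bi1 z y') = m.
  by rewrite compA tq compDl -!compA bp1i1 bp2i1 !compm0 compm1 addr0.
have t2 : t \c (q \c bi2 z y') = ext_inj e'' \c n.
  by rewrite compA tq compDl -!compA bp1i2 bp2i2 !compm0 compm1 add0r.
exists t => /=; split=> //; apply: qE.
  by rewrite -!compA t1 p'm.
by rewrite -!compA t2 p'i compm0 compA pi'' comp0m.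
Qed.

Lemma ext_pullback x x' y (f : hom x' x) (e : extension x y) :
  exists e' : extension x' y, ext_mor (idm y) f e' e /\
    forall x'' y'' (n : hom x'' x') (g : hom y'' y) (e'' : extension x'' y''),
      ext_mor g (f \c n) e'' e -> ext_mor g n e'' e'.
Proof.
case: e => z i p ip; have [mi _ ep] := ip.
have [[pi K] [_ Q]] := (short_exactP _ _).1 ip.
pose d := p \c bp1 z x' - f \c bp2 z x'.
have di1 : d \c bi1 z x' = p.
  by rewrite compBl -!compA bp1i1 bp2i1 compm1 compm0 subr0.
have ed : epi d.
  by apply: epiP => w t dt; apply: (epi0 ep); rewrite -di1 compA dt comp0m.
have [P [k kc]] := ab_kernel d.
have [_ Qd] := epi_cokernel_kernel ed kc.
have mk := kernel_mono kc; have [dk Hk] := kc.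
have sq : p \c (bp1 z x' \c k) = f \c (bp2 z x' \c k).
  by apply: subr0_eq; rewrite !compA -compBl.
have [|i' [ki' _]] := Hk _ (bi1 z x' \c i); first by rewrite compA di1.
have mi' : bp1 z x' \c k \c i' = i.
  by rewrite -compA ki' compA bp1i1 comp1m.
have pi' : bp2 z x' \c k \c i' = 0.
  by rewrite -compA ki' compA bp2i1 comp0m.
have kE w (t t' : hom w P) : bp1 z x' \c k \c t = bp1 z x' \c k \c t' ->
    bp2 z x' \c k \c t = bp2 z x' \c k \c t' -> t = t'.
  move=> e1 e2; apply: mk; rewrite -[k \c t]comp1m -[k \c t']comp1m -!bipE.
  by rewrite !compDl -!compA !(compA _ k) e1 e2.
have ip' : short_exact i' (bp2 z x' \c k).
  apply/short_exactP.
  have mj' : mono i'.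
    apply: monoP => w t tp; apply: (mono0 mi).
    by rewrite -mi' -compA tp compm0.
  have ep' : epi (bp2 z x' \c k).
    apply: epiP => w t; rewrite compA => /Qd[r [rd _]].
    have r0 : r = 0.
      by apply: (epi0 ep); rewrite -di1 compA rd -compA bp2i1 compm0.
    by rewrite -[t]compm1 -(bp2i2 z x') compA -rd r0 !comp0m.
  have cp' : is_kernel i' (bp2 z x' \c k).
    apply: kernelP => // w t ti.
    have [|s [sp _]] := K _ (bp1 z x' \c k \c t).
      by rewrite compA sq -compA ti compm0.
    exists s; apply: kE; first by rewrite compA mi'.
    by rewrite compA pi' comp0m ti.
  by split=> //; apply: epi_cokernel_kernel.
exists (Extension ip'); split.
  by exists (bp1 z x' \c k) => /=; rewrite compm1.
move=> x'' y'' n g e'' [m /= [mi'' pm]].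
have [|t [tk _]] := Hk _ (bi1 z x' \c m + bi2 z x' \c n \c ext_proj e'').
  rewrite compDr (compA d) di1 pm !compA -compDl.
  suff -> : d \c bi2 z x' = - f by rewrite compNm subrr comp0m.
  by rewrite /d compBl -!compA bp1i2 bp2i2 compm1 compm0 sub0r.
have [[pi'' _] _] := (short_exactP _ _).1 (ext_exact e'').
have t1 : bp1 z x' \c k \c t = m.
  by rewrite -compA tk compDr !compA bp1i1 bp1i2 !comp0m comp1m addr0.
have t2 : bp2 z x' \c k \c t = n \c ext_proj e''.
  by rewrite -compA tk compDr !compA bp2i1 bp2i2 !comp0m comp1m add0r.
exists t => /=; split=> //; apply: kE.
  by rewrite !compA t1 mi' mi''.
by rewrite !compA t2 pi' comp0m -compA pi'' compm0.
Qed.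

Lemma ext_push_factor x y y' x'' y'' (g : hom y y') (n : hom y' y'')
    (f : hom x x'') (e : extension x y) (e' : extension x y')
    (e'' : extension x'' y'') :
  ext_mor g (idm x) e e' -> ext_mor (n \c g) f e e'' -> ext_mor n f e' e''.
Proof.
move=> ee' ee''; have [P [eP H]] := ext_pushout g e.
have Pe' : ext_equiv P e' by apply: H; rewrite comp1m.
have := ext_mor_comp (ext_equiv_sym Pe') (H _ _ _ _ _ ee'').
by rewrite !compm1.
Qed.

Lemma ext_pull_factor x x' y x'' y'' (f : hom x' x) (n : hom x'' x')
    (g : hom y'' y) (e : extension x y) (e' : extension x' y)
    (e'' : extension x'' y'') :
  ext_mor (idm y) f e' e -> ext_mor g (f \c n) e'' e -> ext_mor g n e'' e'.
Proof.
move=> e'e ee''; have [P [Pe H]] := ext_pullback f e.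
have e'P : ext_equiv e' P by apply: H; rewrite compm1.
have := ext_mor_comp (H _ _ _ _ _ ee'') (ext_equiv_sym e'P).
by rewrite !comp1m.
Qed.

Definition ext_push x y y' (g : hom y y') (e : extension x y) : extension x y' :=
  projT1 (cid (ext_pushout g e)).

Definition ext_pull x x' y (f : hom x' x) (e : extension x y) : extension x' y :=
  projT1 (cid (ext_pullback f e)).

Lemma ext_pushP x y y' (g : hom y y') (e : extension x y) :
  ext_mor g (idm x) e (ext_push g e).
Proof. by rewrite /ext_push; case: cid => ? []. Qed.

Lemma ext_pullP x x' y (f : hom x' x) (e : extension x y) :
  ext_mor (idm y) f (ext_pull f e) e.
Proof. by rewrite /ext_pull; case: cid => ? []. Qed.

Definition bip_map x y x' y' (f : hom x x') (g : hom y y') :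
    hom (bip x y) (bip x' y') :=
  bi1 x' y' \c f \c bp1 x y + bi2 x' y' \c g \c bp2 x y.

Definition diagonal x : hom x (bip x x) := bi1 x x + bi2 x x.
Definition codiagonal x : hom (bip x x) x := bp1 x x + bp2 x x.

Lemma bp1_map x y x' y' (f : hom x x') (g : hom y y') :
  bp1 x' y' \c bip_map f g = f \c bp1 x y.
Proof. by rewrite compDr !compA bp1i1 bp1i2 !comp0m comp1m addr0. Qed.

Lemma bp2_map x y x' y' (f : hom x x') (g : hom y y') :
  bp2 x' y' \c bip_map f g = g \c bp2 x y.
Proof. by rewrite compDr !compA bp2i1 bp2i2 !comp0m comp1m add0r. Qed.

Lemma bip_map1 x y x' y' (f : hom x x') (g : hom y y') :
  bip_map f g \c bi1 x y = bi1 x' y' \c f.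
Proof. by rewrite compDl -!compA bp1i1 bp2i1 !compm0 compm1 addr0. Qed.

Lemma bip_map2 x y x' y' (f : hom x x') (g : hom y y') :
  bip_map f g \c bi2 x y = bi2 x' y' \c g.
Proof. by rewrite compDl -!compA bp1i2 bp2i2 !compm0 compm1 add0r. Qed.

Lemma bip_homP w x y (s t : hom w (bip x y)) :
  bp1 x y \c s = bp1 x y \c t -> bp2 x y \c s = bp2 x y \c t -> s = t.
Proof.
move=> e1 e2; rewrite -[s]comp1m -[t]comp1m -bipE !compDl -!compA.
by rewrite e1 e2.
Qed.

Lemma bip_mapP w x y (s t : hom (bip x y) w) :
  s \c bi1 x y = t \c bi1 x y -> s \c bi2 x y = t \c bi2 x y -> s = t.
Proof.
move=> e1 e2; rewrite -[s]compm1 -[t]compm1 -bipE !compDr !compA.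
by rewrite e1 e2.
Qed.

Lemma short_exact_bip x y z x' y' z' (i : hom y z) (p : hom z x)
    (i' : hom y' z') (p' : hom z' x') :
  short_exact i p -> short_exact i' p' ->
  short_exact (bip_map i i') (bip_map p p').
Proof.
move=> /short_exactP[[pi K] [_ Q]] /short_exactP[[pi' K'] [_ Q']].
apply/short_exactP; split; split.
- by apply: bip_homP; rewrite compA ?bp1_map ?bp2_map -compA ?bp1_map ?bp2_map
    compA ?pi ?pi' comp0m compm0.
- move=> w t et.
  have [|s [es us]] := K _ (bp1 _ _ \c t).
    by rewrite compA -(bp1_map p p') -compA et compm0.
  have [|s' [es' us']] := K' _ (bp2 _ _ \c t).
    by rewrite compA -(bp2_map p p') -compA et compm0.
  exists (bi1 y y' \c s + bi2 y y' \c s'); split.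
    apply: bip_homP; rewrite compA ?bp1_map ?bp2_map -compA compDr.
      by rewrite !compA bp1i1 bp1i2 comp0m addr0 comp1m.
    by rewrite !compA bp2i1 bp2i2 comp0m add0r comp1m.
  move=> r er; apply: bip_homP; rewrite compDr !compA.
    rewrite bp1i1 bp1i2 comp0m addr0 comp1m; apply: us.
    by rewrite compA -(bp1_map i i') -compA er.
  rewrite bp2i1 bp2i2 comp0m add0r comp1m; apply: us'.
  by rewrite compA -(bp2_map i i') -compA er.
- by apply: bip_homP; rewrite compA ?bp1_map ?bp2_map -compA ?bp1_map ?bp2_map
    compA ?pi ?pi' comp0m compm0.
- move=> w t et.
  have [|s [es us]] := Q _ (t \c bi1 _ _).
    by rewrite -compA -(bip_map1 i i') compA et comp0m.
  have [|s' [es' us']] := Q' _ (t \c bi2 _ _).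
    by rewrite -compA -(bip_map2 i i') compA et comp0m.
  exists (s \c bp1 x x' + s' \c bp2 x x'); split.
    apply: bip_mapP; rewrite -compA ?bip_map1 ?bip_map2 compA compDl -!compA.
      by rewrite bp1i1 bp2i1 compm0 addr0 compm1.
    by rewrite bp1i2 bp2i2 compm0 add0r compm1.
  move=> r er; apply: bip_mapP; rewrite compDl -!compA.
    rewrite bp1i1 bp2i1 compm0 addr0 compm1; apply: us.
    by rewrite -compA -(bip_map1 p p') compA er.
  rewrite bp1i2 bp2i2 compm0 add0r compm1; apply: us'.
  by rewrite -compA -(bip_map2 p p') compA er.
Qed.

Definition ext_dsum x y x' y' (e : extension x y) (e' : extension x' y') :
    extension (bip x x') (bip y y') :=
  Extension (short_exact_bip (ext_exact e) (ext_exact e')).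

Lemma short_exact_split x y : short_exact (bi1 y x) (bp2 y x).
Proof.
apply/short_exactP; split.
  apply: kernelP; rewrite ?bp2i1 //.
    by apply: monoP => w t /(congr1 (comp (bp1 y x)));
      rewrite compA bp1i1 comp1m compm0.
  move=> w t et; exists (bp1 y x \c t); apply: bip_homP.
    by rewrite !compA bp1i1 comp1m.
  by rewrite et !compA bp2i1 !comp0m.
apply: cokernelP; rewrite ?bp2i1 //.
  by apply: epiP => w t /(congr1 (fun u => comp u (bi2 y x)));
    rewrite -compA bp2i2 compm1 comp0m.
move=> w t et; exists (t \c bi2 y x); apply: bip_mapP.
  by rewrite et -!compA bp2i1 !compm0.
by rewrite -!compA bp2i2 compm1.
Qed.

Definition ext_split x y : extension x y := Extension (short_exact_split x y).

End ExtensionFacts.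

Section ExtGroup.
Variables (A : abelian) (E : ext_sets A).
Implicit Types x y : A.

Definition ext_repr x y (c : E x y) : extension x y :=
  projT1 (cid (ext_class_surj c)).

Lemma ext_reprK x y (c : E x y) : ext_class E (ext_repr c) = c.
Proof. by rewrite /ext_repr; case: cid. Qed.

Definition Ext_push x y y' (g : hom y y') (c : E x y) : E x y' :=
  ext_class E (ext_push g (ext_repr c)).

Definition Ext_pull x x' y (f : hom x' x) (c : E x y) : E x' y :=
  ext_class E (ext_pull f (ext_repr c)).

Definition Ext_zero x y : E x y := ext_class E (ext_split x y).

Definition Ext_opp x y (c : E x y) : E x y := Ext_push (- idm y) c.

(* The Baer sum. *)
Definition Ext_add x y (c c' : E x y) : E x y :=
  Ext_push (codiagonal y)
    (Ext_pull (diagonal x) (ext_class E (ext_dsum (ext_repr c) (ext_repr c')))).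

Lemma Ext_pushE x y y' (g : hom y y') (e : extension x y) (e' : extension x y') :
  Ext_push g (ext_class E e) = ext_class E e' <-> ext_mor g (idm x) e e'.
Proof.
have re : ext_equiv (ext_repr (ext_class E e)) e.
  by apply/ext_classP; exact: ext_reprK.
have rP := ext_pushP g (ext_repr (ext_class E e)).
split=> [/ext_classP Pe'|ee'].
  have := ext_mor_comp (ext_mor_comp (ext_equiv_sym re) rP) Pe'.
  by rewrite !comp1m compm1.
apply/ext_classP; apply: ext_push_factor rP _.
by have := ext_mor_comp re ee'; rewrite !comp1m compm1.
Qed.

Lemma Ext_pullE x x' y (f : hom x' x) (e : extension x y) (e' : extension x' y) :
  Ext_pull f (ext_class E e) = ext_class E e' <-> ext_mor (idm y) f e' e.
Proof.
have re : ext_equiv (ext_repr (ext_class E e)) e.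
  by apply/ext_classP; exact: ext_reprK.
have rP := ext_pullP f (ext_repr (ext_class E e)).
split=> [/ext_classP Pe'|ee'].
  have := ext_mor_comp (ext_mor_comp (ext_equiv_sym Pe') rP) re.
  by rewrite !comp1m compm1.
apply/ext_classP/ext_equiv_sym; apply: ext_pull_factor rP _.
by have := ext_mor_comp ee' (ext_equiv_sym re); rewrite !compm1 comp1m.
Qed.

Lemma Ext_push_pull x y x' y' (g : hom y y') (f : hom x x')
    (e : extension x y) (e' : extension x' y') :
  ext_mor g f e e' ->
  Ext_push g (ext_class E e) = Ext_pull f (ext_class E e').
Proof.
move=> ee'; rewrite -(ext_reprK (Ext_push g _)).
set P := ext_repr _.
have eP : ext_mor g (idm x) e P by apply/Ext_pushE; rewrite ext_reprK.
apply/esym/Ext_pullE; apply: ext_push_factor eP _.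
by rewrite comp1m.
Qed.

Lemma Ext_push1 x y (c : E x y) : Ext_push (idm y) c = c.
Proof.
rewrite -(ext_reprK c); apply/Ext_pushE; exact: ext_equiv_refl.
Qed.

Lemma Ext_pull1 x y (c : E x y) : Ext_pull (idm x) c = c.
Proof.
rewrite -(ext_reprK c); apply/Ext_pullE; exact: ext_equiv_refl.
Qed.

Lemma Ext_pushM x y y' y'' (g' : hom y' y'') (g : hom y y') (c : E x y) :
  Ext_push (g' \c g) c = Ext_push g' (Ext_push g c).
Proof.
rewrite -(ext_reprK c).
have [e' [ce' _]] := ext_pushout g (ext_repr c).
have [e'' [ce'' _]] := ext_pushout g' e'.
rewrite ((Ext_pushE _ _ _).2 ce') ((Ext_pushE _ _ _).2 ce'').
by apply/Ext_pushE; have := ext_mor_comp ce' ce''; rewrite comp1m.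
Qed.

Lemma Ext_pullM x x' x'' y (f : hom x' x) (f' : hom x'' x') (c : E x y) :
  Ext_pull (f \c f') c = Ext_pull f' (Ext_pull f c).
Proof.
rewrite -(ext_reprK c).
have [e' [ce' _]] := ext_pullback f (ext_repr c).
have [e'' [ce'' _]] := ext_pullback f' e'.
rewrite ((Ext_pullE _ _ _).2 ce') ((Ext_pullE _ _ _).2 ce'').
by apply/Ext_pullE; have := ext_mor_comp ce'' ce'; rewrite comp1m.
Qed.

Lemma Ext_pushC x x' y y' (f : hom x' x) (g : hom y y') (c : E x y) :
  Ext_push g (Ext_pull f c) = Ext_pull f (Ext_push g c).
Proof.
rewrite -(ext_reprK c).
have [e' [e'c _]] := ext_pullback f (ext_repr c).
have [e'' [ce'' _]] := ext_pushout g (ext_repr c).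
rewrite ((Ext_pullE _ _ _).2 e'c) ((Ext_pushE _ _ _).2 ce'').
apply: Ext_push_pull.
by have := ext_mor_comp e'c ce''; rewrite comp1m compm1.
Qed.

Lemma Ext_push0 x y y' (c : E x y) : Ext_push (0 : hom y y') c = Ext_zero x y'.
Proof.
rewrite -(ext_reprK c); apply/Ext_pushE.
set e := ext_repr c; have [[pi _] _] := (short_exactP _ _).1 (ext_exact e).
exists (bi2 y' x \c ext_proj e) => /=; split.
  by rewrite -compA pi !compm0.
by rewrite compA bp2i2.
Qed.

Lemma Ext_pushD x y y' (a b : hom y y') (c : E x y) :
  Ext_push (a + b) c = Ext_add (Ext_push a c) (Ext_push b c).
Proof.
have [[m1 [mi1 pm1]] [m2 [mi2 pm2]]] : ext_mor a (idm x) (ext_repr c) (ext_repr (Ext_push a c)) /\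
               ext_mor b (idm x) (ext_repr c) (ext_repr (Ext_push b c)).
  by split; apply/Ext_pushE; rewrite !ext_reprK.
rewrite /Ext_add.
have -> : a + b = codiagonal y' \c (bi1 y' y' \c a + bi2 y' y' \c b).
  rewrite compDr !compA !compDl bp1i1 bp1i2 bp2i1 bp2i2 !comp0m.
  by rewrite addr0 add0r !comp1m.
rewrite Ext_pushM -[c in LHS]ext_reprK; congr Ext_push; apply: Ext_push_pull.
exists (bi1 _ _ \c m1 + bi2 _ _ \c m2) => /=; split.
  rewrite (compDr (bip_map _ _)) 2!(compA (bip_map _ _)) bip_map1 bip_map2.
  by rewrite compDl -!compA mi1 mi2.
rewrite (compDr (bip_map _ _)) 2!(compA (bip_map _ _)) bip_map1 bip_map2.
by rewrite compDl -!compA pm1 pm2 !comp1m.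
Qed.

Lemma Ext_pairing x y y' (c : E x y) (c' : E x y') :
  exists d : E x (bip y y'),
    Ext_push (bp1 y y') d = c /\ Ext_push (bp2 y y') d = c'.
Proof.
exists (Ext_pull (diagonal x)
  (ext_class E (ext_dsum (ext_repr c) (ext_repr c')))).
have H1 : ext_mor (bp1 y y') (bp1 x x)
    (ext_dsum (ext_repr c) (ext_repr c')) (ext_repr c).
  by exists (bp1 _ _); rewrite /= !bp1_map.
have H2 : ext_mor (bp2 y y') (bp2 x x)
    (ext_dsum (ext_repr c) (ext_repr c')) (ext_repr c').
  by exists (bp2 _ _); rewrite /= !bp2_map.
rewrite !Ext_pushC (Ext_push_pull H1) (Ext_push_pull H2) -!Ext_pullM !ext_reprK.
by rewrite !compDr bp1i1 bp1i2 bp2i1 bp2i2 addr0 add0r !Ext_pull1.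
Qed.

Lemma Ext_addA x y : associative (@Ext_add x y).
Proof.
move=> c1 c2 c3.
have [d [d1 d2]] := Ext_pairing c1 c2.
have [e [e1 e2]] := Ext_pairing d c3.
rewrite -d1 -d2 -e2 -e1 -!Ext_pushM -!Ext_pushD.
by rewrite addrA.
Qed.

Lemma Ext_addC x y : commutative (@Ext_add x y).
Proof.
move=> c1 c2; have [d [<- <-]] := Ext_pairing c1 c2.
by rewrite -!Ext_pushD addrC.
Qed.

Lemma Ext_add0 x y : left_id (Ext_zero x y) (@Ext_add x y).
Proof.
move=> c; rewrite -(Ext_push0 _ c) -{2 3}(Ext_push1 c) -Ext_pushD.
by rewrite add0r.
Qed.

Lemma Ext_addN x y : left_inverse (Ext_zero x y) (@Ext_opp x y) (@Ext_add x y).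
Proof.
move=> c; rewrite /Ext_opp -{2}(Ext_push1 c) -Ext_pushD addNr.
exact: Ext_push0.
Qed.

HB.instance Definition _ x y := gen_eqMixin (E x y).
HB.instance Definition _ x y := gen_choiceMixin (E x y).
HB.instance Definition _ x y := GRing.isZmodule.Build (E x y)
  (@Ext_addA x y) (@Ext_addC x y) (@Ext_add0 x y) (@Ext_addN x y).

Definition Ext_act x' x y y' (f : hom x' x) (g : hom y y') (c : E x y) : E x' y' :=
  Ext_push g (Ext_pull f c).

Lemma Ext_act_additive x' x y y' (f : hom x' x) (g : hom y y') :
  zmod_morphism (Ext_act f g).
Proof.
have aD (c d : E x y) : Ext_act f g (c + d) = Ext_act f g c + Ext_act f g d.
  have [e [<- <-]] := Ext_pairing c d.
  rewrite /GRing.add /= -Ext_pushD /Ext_act -!Ext_pushC -!Ext_pushM -Ext_pushD.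
  by rewrite compDr.
by move=> c d; apply: (addIr (Ext_act f g d)); rewrite -aD !subrK.
Qed.

HB.instance Definition _ x' x y y' (f : hom x' x) (g : hom y y') :=
  GRing.isZmodMorphism.Build (E x y) (E x' y')
    (Ext_act f g) (Ext_act_additive f g).

Lemma Ext_act1 x y (c : E x y) : Ext_act (idm x) (idm y) c = c.
Proof. by rewrite /Ext_act Ext_pull1 Ext_push1. Qed.

Lemma Ext_actM x'' x' x y y' y'' (f' : hom x'' x') (f : hom x' x)
    (g : hom y y') (g' : hom y' y'') (c : E x y) :
  Ext_act (f \c f') (g' \c g) c = Ext_act f' g' (Ext_act f g c).
Proof. by rewrite /Ext_act Ext_pushM Ext_pullM Ext_pushC. Qed.

(* (X, Y) |-> Ext^1(F X, G Y). *)
Definition Ext_bifunctor (C : preadditive) (F G : functor C A) : bifunctor C.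
Proof.
exists (fun X Y => E (F X) (G Y) : zmodType)
       (fun X' X Y Y' f g => Ext_act (fmap F f) (fmap G g) : {additive _ -> _}).
- by move=> X Y c; rewrite /= !fmap1 Ext_act1.
- by move=> *; rewrite /= !fmapM Ext_actM.
Defined.

End ExtGroup.

(* Main.v *)
Require Import Defs.
From HB Require Import structures.
From mathcomp Require Import all_boot ssralg.
From mathcomp Require Import boolp.

Set Implicit Arguments.
Unset Strict Implicit.
Unset Printing Implicit Defensive.

Import GRing.Theory Defs.
Local Open Scope ring_scope.

(** Let [f : X -> Y] satisfy [h f = 0] and complete it to a triangle
    [X -> Y -> C -> X[1]]. The long exact sequence breaks up into a short exact
    sequence [0 -> h Y -> h C -> h (X[1]) -> 0], that is, into an extension of
    [s (h X)] by [h Y]. Everything follows from the assignment of this extension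
    to [f] (relation [cone_ext]).

    The axiom on morphisms of triangles makes the assignment functorial: a
    commutative square between such maps induces a morphism of extensions
    ([cone_ext_mor]); hence the class is well defined and compatible with
    pushouts and pullbacks. If the extension splits then [f = 0]: by fullness the
    splitting comes from [T], and since [h] reflects isomorphisms it splits the
    map [C -> X[1]] of the triangle ([cone_ext_split0]).

    Square zero. The extension of [g \c f] is a pushout of that of [f] along
    [h g = 0], so it splits and [g \c f = 0] ([ker_ideal_square_zero]).

    Isomorphism with Ext. The class is additive because the sum [f + g] factors
    through the pairing of [f] and [g] into the biproduct ([cone_classD]), and
    injective by the splitting property. It is surjective because, once the middle
    term of an extension is [h C], fullness lifts the inclusion to [Y -> C] and
    the third vertex of a triangle on it has homology [h (X[1])], hence is
    isomorphic to [X[1]] ([cone_ext_surj]).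

    Heredity. In an exact sequence [0 -> u -> v -> w -> x -> 0] let [J] be the
    image of [v -> w]. Realizing [u -> v] by a map with third vertex [K], one gets
    a triangle [U -> V -> K -> U[1]] with [h K = J] whose last map is killed by
    [h]. The extension [w] of [x] by [J] corresponds to some [f : X -> K] killed
    by [h]; as the ideal has square zero, [f] lifts to [V], and the lift can be
    corrected to be killed by [h]. Its extension is the one sought
    ([hereditary_of_realizes]).

    Idempotents. They split in [A], the splitting lifts to [T], and two idempotents
    with the same homology are conjugate ([idempotents_split_of_realizes]). *)

(** * Isomorphisms, monomorphisms and epimorphisms *)

Section Isomorphisms.
Variable C : preadditive.
Implicit Types X Y Z : C.

Lemma isom_mono X Y (f : hom X Y) : isom f -> mono f.
Proof.
move=> [g [gf _]] W s t /(congr1 (fun r => g \c r)).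
by rewrite !compA gf !comp1m.
Qed.

Lemma isom_epi X Y (f : hom X Y) : isom f -> epi f.
Proof.
move=> [g [_ fg]] W s t /(congr1 (fun r => r \c g)).
by rewrite -!compA fg !compm1.
Qed.

Lemma isom_idm X : isom (idm X).
Proof. by exists (idm X); rewrite comp1m. Qed.

Lemma isom_comp X Y Z (g : hom Y Z) (f : hom X Y) :
  isom g -> isom f -> isom (g \c f).
Proof.
move=> [g' [g'g gg']] [f' [f'f ff']]; exists (f' \c g'); split.
  by rewrite compA -(compA f') g'g compm1.
by rewrite compA -(compA g) ff' compm1.
Qed.

Lemma isomorphic_sym X Y : isomorphic X Y -> isomorphic Y X.
Proof. by move=> [f [g [gf fg]]]; exists g, f. Qed.

Lemma mono_comp X Y Z (g : hom Y Z) (f : hom X Y) :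
  mono g -> mono f -> mono (g \c f).
Proof. by move=> mg mf W s t; rewrite -!compA => /mg/mf. Qed.

Lemma epi_comp X Y Z (g : hom Y Z) (f : hom X Y) :
  epi g -> epi f -> epi (g \c f).
Proof. by move=> eg ef W s t; rewrite !compA => /ef/eg. Qed.

Lemma cokernel_unique X Y Q Q' (f : hom X Y) (q : hom Y Q) (q' : hom Y Q') :
  is_cokernel q f -> is_cokernel q' f -> exists r : hom Q Q', isom r /\ r \c q = q'.
Proof.
move=> cq cq'; have [[qf H] [q'f H']] := (cq, cq').
have [r [rq _]] := H _ _ q'f; have [r' [rq' _]] := H' _ _ qf.
exists r; split=> //; exists r'; split.
  by apply: (cokernel_epi cq); rewrite -compA rq rq' comp1m.
by apply: (cokernel_epi cq'); rewrite -compA rq' rq comp1m.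
Qed.

Lemma short_exact_isom X Y Z X' Z' (a : hom X' X) (i : hom X Y) (p : hom Y Z)
    (b : hom Z Z') :
  isom a -> isom b -> is_kernel i p -> is_cokernel p i ->
  is_kernel (i \c a) (b \c p) /\ is_cokernel (b \c p) (i \c a).
Proof.
move=> ia ib ki cp.
have [a' [_ aa']] := ia; have [b' [b'b _]] := ib.
have [[pi K] [_ Q]] := (ki, cp).
have e0 : (b \c p) \c (i \c a) = 0.
  by rewrite -compA (compA p) pi comp0m compm0.
split.
  apply: kernelP => //; first exact: mono_comp (kernel_mono ki) (isom_mono ia).
  move=> W t; rewrite -compA => /(mono0 (isom_mono ib))/K[s [<- _]].
  by exists (a' \c s); rewrite -!compA (compA a) aa' comp1m.
apply: cokernelP => //; first exact: epi_comp (isom_epi ib) (cokernel_epi cp).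
move=> W t; rewrite compA => /(epi0 (isom_epi ia))/Q[s [<- _]].
by exists (s \c b'); rewrite -!compA (compA b') b'b comp1m.
Qed.

Lemma cokernel_isom X Y Q X' Y' Q' (f : hom X Y) (q : hom Y Q)
    (u : hom X' X) (v : hom Y' Y) (v' : hom Y Y') (b : hom Q Q') :
  epi u -> v \c v' = idm Y -> v' \c v = idm Y' -> isom b ->
  is_cokernel q f -> is_cokernel (b \c q \c v) (v' \c f \c u).
Proof.
move=> eu vv' v'v ib cq; have [[qf H] [b' [b'b _]]] := (cq, ib).
apply: cokernelP.
- apply: epi_comp; first exact: epi_comp (isom_epi ib) (cokernel_epi cq).
  by apply: isom_epi; exists v'.
- by rewrite !compA -(compA _ v) vv' compm1 -(compA b) qf compm0 comp0m.
- move=> W t; rewrite compA => /(epi0 eu); rewrite compA => /H[r [rq _]].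
  exists (r \c b'); rewrite !compA -(compA r) b'b compm1 rq.
  by rewrite -compA v'v compm1.
Qed.

End Isomorphisms.

(** * Equivalences of categories *)

Section Equivalences.
Variables C D : preadditive.

Lemma fmap_isom (F : functor C D) X Y (f : hom X Y) : isom f -> isom (fmap F f).
Proof.
by move=> [g [gf fg]]; exists (fmap F g); rewrite -!fmapM gf fg !fmap1.
Qed.

Lemma equivalence_sym (F : functor C D) : is_equivalence F ->
  exists G : functor D C, is_equivalence G /\
    nat_isomorphic (comp_functor G F) (id_functor C).
Proof. by move=> [G [GF FG]]; exists G; split=> //; exists F. Qed.

Lemma equivalence_faithful (F : functor C D) X Y (f g : hom X Y) :
  is_equivalence F -> fmap F f = fmap F g -> f = g.
Proof.
move=> [G [[a [ia na]] _]] e; apply: (isom_epi (ia X)).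
by have := na _ _ f; rewrite /= e (na _ _ g).
Qed.

End Equivalences.

Section EquivalenceProperties.
Variables C D : preadditive.

Lemma equivalence_full (F : functor C D) : is_equivalence F -> full F.
Proof.
move=> /equivalence_sym[G [eG [a [ia na]]]] X Y g.
have [a' [a'a aa']] := ia X.
exists (a Y \c fmap G g \c a'); apply: (equivalence_faithful eG).
apply: (isom_mono (ia Y)); rewrite [LHS]na /=.
by rewrite -!compA a'a compm1.
Qed.

Lemma equivalence_surj (F : functor C D) : is_equivalence F ->
  forall y : D, exists x : C, isomorphic (F x) y.
Proof. by move=> [G [_ [b [ib _]]]] y; exists (G y), (b y); exact: ib. Qed.

Lemma equivalence_mono (F : functor C D) X Y (f : hom X Y) :
  is_equivalence F -> mono f -> mono (fmap F f).
Proof.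
move=> /equivalence_sym[G [eG [a [ia na]]]] mf W s t e.
apply: (equivalence_faithful eG); apply: (isom_mono (ia X)); apply: mf.
by rewrite !compA -[f \c a X](na _ _ f) /= -!compA -!fmapM e.
Qed.

End EquivalenceProperties.

(** A functor with zero object in its source preserves zero maps as soon as it
    preserves that object. A full functor does, since the only endomorphism of
    the zero object is the identity. *)
Lemma equivalence0 (C : additive) (D : preadditive) (F : functor C D) (X Y : C) :
  is_equivalence F -> fmap F (0 : hom X Y) = 0.
Proof.
move=> eF; set Z := zero_obj C; have [_ Z0] := zero_objP C.
have FZ : idm (F Z) = 0.
  have [f <-] := equivalence_full eF (0 : hom (F Z) (F Z)).
  by rewrite -fmap1; congr fmap; rewrite (Z0 _ f); exact: Z0.
rewrite -(comp0m Y (0 : hom X Z)) fmapM -(comp1m (fmap F (0 : hom X Z))) FZ.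
by rewrite comp0m compm0.
Qed.

(** * Exactness in abelian categories *)

Section Exactness.
Variable A : abelian.
Implicit Types x y z : A.

Lemma exact0_mono x y z (g : hom y z) : exact (0 : hom x y) g -> mono g.
Proof.
move=> [J [j [[Q [q [[_ Hq] [qj _]]]] [_ Hj]]]].
have [|l [lq _]] := Hq _ (idm y); first by rewrite compm0.
apply: monoP => w t /Hj[r [<- _]].
by rewrite -[j]comp1m -lq -(compA l) qj compm0 comp0m.
Qed.

Lemma exact0_epi x y z (f : hom x y) : exact f (0 : hom y z) -> epi f.
Proof.
move=> [J [j [[Q [q [[_ Hq] [qj _]]]] [_ Hj]]]].
have [|l [jl _]] := Hj _ (idm y); first by rewrite comp0m.
apply: epiP => w t /Hq[r [<- _]].
by rewrite -[q]compm1 -jl (compA q) qj comp0m compm0.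
Qed.

(** The kernel of a map killing [b] would give a smaller kernel in [y] through
    which [f] factors; the cokernel of [f] forbids it. *)
Lemma image_epi x y J (f : hom x y) (j : hom J y) (b : hom x J) :
  is_image j f -> j \c b = f -> epi b.
Proof.
move=> [Q [q [[qf Hq] kj]]] jb; have [qj _] := kj.
apply: epiP => w t tb.
have [K [k kk]] := ab_kernel t; have [tk Hk] := kk.
have [b' [kb' _]] := Hk _ _ tb.
have mjk := mono_comp (kernel_mono kj) (kernel_mono kk).
have [v [r [rjk Hr]]] := ab_mono_kernel mjk.
have [|r' [r'q _]] := Hq _ r; first by rewrite -jb -kb' !(compA j) compA rjk comp0m.
have [|l [jkl _]] := Hr _ j; first by rewrite -r'q -compA qj compm0.
have kl : k \c l = idm J.
  by apply: (kernel_mono kj); rewrite compA jkl compm1.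
by rewrite -[t]compm1 -kl compA tk comp0m.
Qed.

Lemma abelian_idempotents_split : idempotents_split A.
Proof.
move=> x e ee.
have [K [i ki]] := ab_kernel (idm x - e); have [ei Hi] := ki.
have eiE : e \c i = i.
  by apply/esym/subr0_eq; rewrite -{1}[i]comp1m -compBl.
have [|p [ip _]] := Hi _ e; first by rewrite compBl comp1m ee subrr.
exists K, i, p; split=> //; apply: (kernel_mono ki).
by rewrite compA ip eiE compm1.
Qed.

(** The middle map kills the subobject, so it factors through the quotient [x];
    the factorization is the section. *)
Lemma ext_mor0_section x y y' (e : extension x y) (e' : extension x y') :
  ext_mor (0 : hom y y') (idm x) e e' ->
  exists t : hom x (ext_mid e'), ext_proj e' \c t = idm x.
Proof.
move=> [m [mi pm]]; have [_ [_ Q]] := (short_exactP _ _).1 (ext_exact e).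
have [_ _ ep] := ext_exact e.
have [|t [tp _]] := Q _ m; first by rewrite mi compm0.
by exists t; apply: ep; rewrite -compA tp pm.
Qed.

End Exactness.

(** * Triangles *)

Section Triangles.
Variable T : triangulated.
Implicit Types X Y Z : T.

Lemma shift_eq0 X Y (f : hom X Y) : fmap (shift T) f = 0 -> f = 0.
Proof.
move=> f0; have eT := ae_equiv (shift T).
by apply: (equivalence_faithful eT); rewrite f0 equivalence0.
Qed.

(** The axiom on morphisms of triangles completes only the third map, so the
    lift is found after rotating: compare [W -> 0 -> W[1]] with
    [Z -> X[1] -> Y[1]] and take the lift to be a preimage under the shift. *)
Lemma dist_lift W X Y Z (f : hom X Y) (g : hom Y Z) (d : hom Z (shift T X))
    (t : hom W Z) :
  dist f g d -> d \c t = 0 -> exists r : hom W Y, g \c r = t.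
Proof.
move=> /dist_rot/dist_rot D dt; have DW := (dist_rot _ _ _).1 (dist_id W).
have [|w [_ gw]] := dist_mor (u := t) (v := 0) DW D; first by rewrite dt comp0m.
have [r rw] := equivalence_full (ae_equiv (shift T)) w.
exists r; apply: (equivalence_faithful (ae_equiv (shift T))).
apply: oppr_inj; rewrite fmapM rw -compNm gw.
by rewrite fmap1 compmN compm1.
Qed.

End Triangles.

Section HomologyTheory.
Variables (T : triangulated) (A : abelian) (s : auto_equivalence A).
Variable h : homology_theory T s.

Lemma homologyD X Y (f g : hom X Y) : fmap h (f + g) = fmap h f + fmap h g.
Proof. by rewrite [LHS](raddfD (fmap h)). Qed.

Lemma homologyN X Y (f : hom X Y) : fmap h (- f) = - fmap h f.
Proof. by rewrite [LHS](raddfN (fmap h)). Qed.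

Lemma homology_shift_eq0 X Y (f : hom X Y) :
  fmap h (fmap (shift T) f) = 0 <-> fmap h f = 0.
Proof.
have [al [al_iso al_nat]] := hom_shift h.
split=> f0.
  apply: (equivalence_faithful (ae_equiv s)).
  rewrite (equivalence0 _ _ (ae_equiv s)); apply: (epi0 (isom_epi (al_iso X))).
  by have := al_nat _ _ f; rewrite /= f0 compm0.
apply: (mono0 (isom_mono (al_iso Y))).
by rewrite [LHS](al_nat _ _ f) /= f0 (equivalence0 _ _ (ae_equiv s)) comp0m.
Qed.

Lemma homology_shift_mono X Y (f : hom X Y) :
  mono (fmap h f) -> mono (fmap h (fmap (shift T) f)).
Proof.
have [al [al_iso al_nat]] := hom_shift h.
move=> /(equivalence_mono (ae_equiv s)) mf.
apply: monoP => w t e; apply: (mono0 (isom_mono (al_iso X))).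
apply: (mono0 mf).
have := al_nat _ _ f; rewrite /= => e'.
by rewrite compA -e' -compA e compm0.
Qed.

(** The shift of [f] is killed by [h] as well, so the two maps adjacent to the
    short sequence in the long exact one vanish. *)
Lemma triangle_kernel_cokernel X Y Z (f : hom X Y) (g : hom Y Z)
    (d : hom Z (shift T X)) :
  dist f g d -> fmap h f = 0 ->
  is_kernel (fmap h g) (fmap h d) /\ is_cokernel (fmap h d) (fmap h g).
Proof.
move=> D f0; have D' := (dist_rot _ _ _).1 D; have D'' := (dist_rot _ _ _).1 D'.
apply/short_exactP; split; last 1 first.
- apply: (@exact0_epi _ _ _ (h (shift T Y))).
  have := hom_exact h D''.
  by rewrite homologyN (homology_shift_eq0 f).2 // oppr0.
- by have := hom_exact h D; rewrite f0 => /exact0_mono.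
- exact: (hom_exact h D').
Qed.

(** Composing the boundary map with the shift of [f] gives zero, and that shift
    has monomorphic homology. *)
Lemma triangle_mono_cokernel X Y Z (f : hom X Y) (g : hom Y Z)
    (d : hom Z (shift T X)) :
  dist f g d -> mono (fmap h f) ->
  fmap h d = 0 /\ is_cokernel (fmap h g) (fmap h f).
Proof.
move=> D mf; have D' := (dist_rot _ _ _).1 D; have D'' := (dist_rot _ _ _).1 D'.
have d0 : fmap h d = 0.
  apply: (mono0 (homology_shift_mono mf)).
  apply: oppr_inj; rewrite oppr0 -compNm -homologyN -fmapM.
  by rewrite (dist_comp0 D'') homology_map0.
split=> //; apply: ((short_exactP _ _).1 _).2; split=> //.
  exact: (hom_exact h D).
by have := hom_exact h D'; rewrite d0 => /exact0_epi.
Qed.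

End HomologyTheory.

(** * The extension attached to a morphism with zero homology *)

Section FullHomologyTheory.
Variables (T : triangulated) (A : abelian) (s : auto_equivalence A).
Variable h : homology_theory T s.
Variable al : forall X : T, hom (h (shift T X)) (s (h X)).
Hypothesis al_iso : forall X, isom (al X).
Hypothesis al_nat : forall X Y (f : hom X Y),
  al Y \c fmap h (fmap (shift T) f) = fmap s (fmap h f) \c al X.

(** The extension is determined only up to equivalence, and cones only up to a
    non-unique isomorphism; hence a relation. The comparison map [m] is not
    required to be invertible: by the five lemma it is so when [h f = 0]. *)
Definition cone_ext X Y (f : hom X Y) (e : extension (s (h X)) (h Y)) : Prop :=
  exists C (i : hom Y C) (p : hom C (shift T X)) (m : hom (h C) (ext_mid e)),
    [/\ dist f i p, m \c fmap h i = ext_inj e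
      & ext_proj e \c m = al X \c fmap h p].

Lemma cone_ext_exists X Y (f : hom X Y) : fmap h f = 0 -> exists e, cone_ext f e.
Proof.
move=> f0; have [C [i [p D]]] := dist_cone f.
have [ki cp] := triangle_kernel_cokernel D f0.
have := short_exact_isom (isom_idm _) (al_iso X) ki cp.
rewrite compm1 => /short_exactP S.
by exists (Extension S), C, i, p, (idm _); rewrite comp1m compm1.
Qed.

(** The comparison with the extension carried by a cone of [f], inverted by the
    five lemma. *)
Lemma cone_ext_isom X Y (f : hom X Y) (e : extension (s (h X)) (h Y)) :
  fmap h f = 0 -> cone_ext f e ->
  exists C (i : hom Y C) (p : hom C (shift T X)) (n : hom (ext_mid e) (h C)),
    [/\ dist f i p, n \c ext_inj e = fmap h i
      & al X \c fmap h p \c n = ext_proj e].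
Proof.
move=> f0 [C [i [p [m [D mi pm]]]]].
have [ki cp] := triangle_kernel_cokernel D f0.
have := short_exact_isom (isom_idm _) (al_iso X) ki cp.
rewrite compm1 => /short_exactP S.
have [n [nm mn]] := @ext_five _ _ _ (Extension S) e m mi pm.
exists C, i, p, n; split=> //; first by rewrite -mi compA nm comp1m.
by rewrite -pm -compA mn compm1.
Qed.

(** A filler between the two cones, carried to homology, is the middle map. *)
Lemma cone_ext_mor X Y X' Y' (f : hom X Y) (f' : hom X' Y') (u : hom X X')
    (v : hom Y Y') e e' :
  fmap h f = 0 -> cone_ext f e -> cone_ext f' e' -> v \c f = f' \c u ->
  ext_mor (fmap h v) (fmap s (fmap h u)) e e'.
Proof.
move=> f0 /(cone_ext_isom f0)[C [i [p [n [D ni pn]]]]].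
move=> [C' [i' [p' [m [D' mi pm]]]]] vf.
have [w [wi pw]] := dist_mor D D' vf.
exists (m \c fmap h w \c n); split.
  by rewrite -!compA ni -fmapM wi fmapM compA mi.
rewrite !compA pm -(compA (al X')) -fmapM pw fmapM !compA al_nat.
by rewrite -!compA -pn !compA.
Qed.

Hypothesis h_refl : reflects_isos h.
Hypothesis h_full : full h.

Lemma full_isom X Y (r : hom (h X) (h Y)) :
  isom r -> exists f : hom X Y, isom f /\ fmap h f = r.
Proof.
move=> ir; have [f fr] := h_full r.
by exists f; split=> //; apply: h_refl; rewrite fr.
Qed.

(** A section in homology lifts, by fullness, to a map which splits the cone
    projection up to an automorphism; the shift of [f] kills that projection. *)
Lemma cone_ext_split0 X Y (f : hom X Y) e (t : hom (s (h X)) (ext_mid e)) :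
  fmap h f = 0 -> cone_ext f e -> ext_proj e \c t = idm _ -> f = 0.
Proof.
move=> f0 /(cone_ext_isom f0)[C [i [p [n [D ni pn]]]]] pt.
have [r hr] := h_full (n \c t \c al X).
have /h_refl[k [_ pk]] : isom (fmap h (p \c r)).
  suff -> : fmap h (p \c r) = idm _ by exact: isom_idm.
  apply: (isom_mono (al_iso X)).
  by rewrite fmapM hr !compA pn pt comp1m compm1.
apply: shift_eq0; apply: oppr_inj; rewrite oppr0.
have fp := dist_comp0 ((dist_rot _ _ _).1 ((dist_rot _ _ _).1 D)).
by rewrite -[- _]compm1 -pk !compA fp !comp0m.
Qed.

(** The extension of [g \c f] is the pushout of that of [f] along [h g = 0]. *)
Lemma ker_ideal_square_zero : square_zero (ker_ideal h).
Proof.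
move=> X Y Z f g /eqP f0 /eqP g0.
have gf0 : fmap h (g \c f) = 0 by rewrite fmapM g0 comp0m.
have [e ef] := cone_ext_exists f0; have [e' egf] := cone_ext_exists gf0.
have := cone_ext_mor (u := idm X) (v := g) f0 ef egf.
rewrite compm1 g0 !fmap1 => /(_ erefl)/ext_mor0_section[t].
exact: cone_ext_split0.
Qed.

(** The inclusion of [e] lifts to [i : Y -> C]; a cone [D] of [i] has homology
    [h (X[1])], the cokernel of [h i], so [D] may be replaced by [X[1]]. Rotating
    the triangle backwards gives [f]. *)
Lemma cone_ext_surj X Y (e : extension (s (h X)) (h Y)) (C : T) :
  isomorphic (h C) (ext_mid e) ->
  exists f : hom X Y, fmap h f = 0 /\ cone_ext f e.
Proof.
move=> [m im]; have [n [nm mn]] := im.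
have [ki cp] := (short_exactP _ _).1 (ext_exact e).
have [a [aa' a'a]] := al_iso X.
have [i hi] := h_full (n \c ext_inj e).
have mi : mono (fmap h i).
  rewrite hi; apply: mono_comp (kernel_mono ki).
  by apply: isom_mono; exists m.
have [D [q [d Dq]]] := dist_cone i.
have [d0 cq] := triangle_mono_cokernel Dq mi.
have cq' : is_cokernel (a \c ext_proj e \c m) (fmap h i).
  rewrite hi -[n \c _]compm1; apply: cokernel_isom cp => //.
    exact: isom_epi (isom_idm _).
  by exists (al X).
have [r [ir rq]] := cokernel_unique cq cq'.
have [k [ik hk]] := full_isom ir; have [k' [k'k kk']] := ik.
(* The sign is the one introduced by the rotation. *)
have [f hf] := equivalence_full (ae_equiv (shift T)) (- (d \c k')).
have Df : dist f i (k \c q).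
  apply: ((dist_rot _ _ _).2 _).
  apply: dist_isom (isom_idm _) (isom_idm _) ik _ _ _ Dq.
  - by rewrite comp1m compm1.
  - by rewrite compm1.
  - by rewrite hf opprK fmap1 comp1m -compA k'k compm1.
have f0 : fmap h f = 0.
  apply/homology_shift_eq0.
  by rewrite hf homologyN fmapM d0 comp0m oppr0.
exists f; split=> //; exists C, i, (k \c q), m; split=> //.
  by rewrite hi compA mn comp1m.
by rewrite fmapM hk rq !compA a'a comp1m.
Qed.


(** * The natural isomorphism *)

Variable E : ext_sets A.

Definition cone_class X Y (f : hom X Y) (c : E (s (h X)) (h Y)) : Prop :=
  exists e, ext_class E e = c /\ cone_ext f e.

Lemma cone_class_exists X Y (f : hom X Y) : fmap h f = 0 -> exists c, cone_class f c.
Proof.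
by move=> /cone_ext_exists[e fe]; exists (ext_class E e), e.
Qed.

Lemma cone_class_push X Y Y' (v : hom Y Y') (f : hom X Y) c :
  fmap h f = 0 -> cone_class f c -> cone_class (v \c f) (Ext_push (fmap h v) c).
Proof.
move=> f0 [e [<- fe]].
have vf0 : fmap h (v \c f) = 0 by rewrite fmapM f0 compm0.
have [e' ve'] := cone_ext_exists vf0; exists e'; split=> //.
apply/esym/Ext_pushE.
have := cone_ext_mor (u := idm X) f0 fe ve'.
by rewrite compm1 !fmap1; apply.
Qed.

Lemma cone_class_pull X X' Y (u : hom X' X) (f : hom X Y) c :
  fmap h f = 0 -> cone_class f c ->
  cone_class (f \c u) (Ext_pull (fmap s (fmap h u)) c).
Proof.
move=> f0 [e [<- fe]].
have fu0 : fmap h (f \c u) = 0 by rewrite fmapM f0 comp0m.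
have [e' ue'] := cone_ext_exists fu0; exists e'; split=> //.
apply/esym/Ext_pullE.
have := cone_ext_mor (v := idm Y) fu0 ue' fe.
by rewrite comp1m !fmap1; apply.
Qed.

Lemma cone_class_uniq X Y (f : hom X Y) c c' :
  fmap h f = 0 -> cone_class f c -> cone_class f c' -> c = c'.
Proof.
move=> f0 [e [<- fe]] [e' [<- fe']]; apply/ext_classP.
have := cone_ext_mor (u := idm X) (v := idm Y) f0 fe fe'.
by rewrite comp1m compm1 !fmap1; apply.
Qed.

(** Both classes are pushouts of the class of the pairing of [f] and [g] into
    the biproduct, and pushing out is additive in the map; so no direct sum of
    triangles is formed. *)
Lemma cone_classD X Y (f g : hom X Y) c d :
  fmap h f = 0 -> fmap h g = 0 -> cone_class f c -> cone_class g d ->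
  cone_class (f + g) (c + d).
Proof.
move=> f0 g0 fc gd; pose k := bi1 Y Y \c f + bi2 Y Y \c g.
have k1 : bp1 Y Y \c k = f.
  by rewrite compDr !compA bp1i1 bp1i2 comp0m comp1m addr0.
have k2 : bp2 Y Y \c k = g.
  by rewrite compDr !compA bp2i1 bp2i2 comp0m comp1m add0r.
have k0 : fmap h k = 0.
  by rewrite homologyD !fmapM f0 g0 !compm0 addr0.
have [b kb] := cone_class_exists k0.
have -> : c = Ext_push (fmap h (bp1 Y Y)) b.
  by apply: cone_class_uniq fc _ => //; rewrite -k1; apply: cone_class_push.
have -> : d = Ext_push (fmap h (bp2 Y Y)) b.
  by apply: cone_class_uniq gd _ => //; rewrite -k2; apply: cone_class_push.
have -> : f + g = (bp1 Y Y + bp2 Y Y) \c k by rewrite compDl k1 k2.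
rewrite /GRing.add /= -Ext_pushD -homologyD.
exact: cone_class_push.
Qed.

Lemma cone_classN X Y (f : hom X Y) c :
  fmap h f = 0 -> cone_class f c -> cone_class (- f) (- c).
Proof.
move=> f0 /(cone_class_push (- idm Y) f0).
by rewrite compNm comp1m homologyN fmap1.
Qed.

Lemma cone_class0 X Y (f : hom X Y) : fmap h f = 0 -> cone_class f 0 -> f = 0.
Proof.
move=> f0 [e [e0 fe]].
have /ext_classP/ext_equiv_sym[m /= [_ pm]] :
  ext_class E e = ext_class E (ext_split (s (h X)) (h Y)) := e0.
apply: (cone_ext_split0 (t := m \c bi2 _ _) f0 fe).
by rewrite compA pm comp1m bp2i2.
Qed.

Lemma cone_class_inj X Y (f g : hom X Y) c :
  fmap h f = 0 -> fmap h g = 0 -> cone_class f c -> cone_class g c -> f = g.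
Proof.
move=> f0 g0 fc /(cone_classN g0) gc; apply/subr0_eq/cone_class0.
  by rewrite homologyD homologyN f0 g0 subr0.
by rewrite -(subrr c); apply: cone_classD => //; rewrite homologyN g0 oppr0.
Qed.

Hypothesis h_ext : realizes_extensions h.

Lemma cone_class_surj X Y (c : E (s (h X)) (h Y)) :
  exists f : ideal_hom (ker_ideal h) X Y, cone_class (val f) c.
Proof.
have [e ec] := ext_class_surj c.
have [||C Ce] := h_ext (X := Y) (Z := shift T X) (ext_exact e).
- by exists (idm _); exact: isom_idm.
- by apply: isomorphic_sym; exists (al X).
have [f [f0 fe]] := cone_ext_surj Ce.
have fI : f \in ker_ideal h X Y by apply/eqP.
by exists (exist _ f fI), e.
Qed.

Definition ext_to_ker X Y (c : E (s (h X)) (h Y)) : ideal_hom (ker_ideal h) X Y :=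
  projT1 (cid (cone_class_surj c)).

Lemma ext_to_kerP X Y (c : E (s (h X)) (h Y)) : cone_class (val (ext_to_ker c)) c.
Proof. exact: (projT2 (cid (cone_class_surj c))). Qed.

Lemma homology_ker X Y (f : ideal_hom (ker_ideal h) X Y) : fmap h (val f) = 0.
Proof. exact/eqP/(valP f). Qed.

Lemma ext_to_ker_eq X Y (f : ideal_hom (ker_ideal h) X Y) c :
  cone_class (val f) c -> ext_to_ker c = f.
Proof.
move=> fc; apply/val_inj; apply: cone_class_inj (ext_to_kerP c) fc;
  exact: homology_ker.
Qed.

Lemma ext_to_ker_additive X Y : zmod_morphism (@ext_to_ker X Y).
Proof.
move=> c d; apply: ext_to_ker_eq; apply: cone_classD.
- exact: homology_ker.
- by rewrite homologyN homology_ker oppr0.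
- exact: ext_to_kerP.
- by apply: cone_classN (ext_to_kerP d); exact: homology_ker.
Qed.

HB.instance Definition _ X Y :=
  GRing.isZmodMorphism.Build (E (s (h X)) (h Y)) (ideal_hom (ker_ideal h) X Y)
    (@ext_to_ker X Y) (@ext_to_ker_additive X Y).

Lemma ext_to_ker_bij X Y : bijective (@ext_to_ker X Y).
Proof.
pose g (f : ideal_hom (ker_ideal h) X Y) :=
  projT1 (cid (cone_class_exists (homology_ker f))).
have gP f : cone_class (val f) (g f).
  exact: (projT2 (cid (cone_class_exists (homology_ker f)))).
exists g => [c|f]; last exact: ext_to_ker_eq.
by apply: cone_class_uniq (gP _) (ext_to_kerP c); exact: homology_ker.
Qed.

Lemma ext_to_ker_nat X' X Y Y' (u : hom X' X) (v : hom Y Y')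
    (c : E (s (h X)) (h Y)) :
  ext_to_ker (Ext_act (fmap s (fmap h u)) (fmap h v) c) =
  ideal_act u v (ext_to_ker c).
Proof.
apply: ext_to_ker_eq; rewrite /= -compA; apply: cone_class_push.
  by rewrite fmapM homology_ker comp0m.
by apply: cone_class_pull (ext_to_kerP c); exact: homology_ker.
Qed.

Definition ext_ker_iso :
  bifunctor_iso (Ext_bifunctor E (comp_functor s h) h)
                (ideal_bifunctor (ker_ideal h)) :=
  @BifunctorIso _ (Ext_bifunctor E (comp_functor s h) h)
    (ideal_bifunctor (ker_ideal h))
    (fun X Y => @ext_to_ker X Y : {additive _ -> _})
    ext_to_ker_bij ext_to_ker_nat.

(** * Consequences of essential surjectivity *)

(** A triangle realizing [u -> v] has as third vertex an object [K] with
    [h K] the image [J] of [b], and the extension [w] of [x] by [J] comes from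
    some [f : X -> K] with [h f = 0]. Lifting [f] to a map [r'] with [h r' = 0]
    amounts to lifting the class of [w] along [Ext(x, v) -> Ext(x, J)]. *)
Lemma hereditary_of_realizes : realizes_objects h -> hereditary A.
Proof.
move=> h_surj u v w x a b c ma ab bc ec.
have [J [j [jb kc]]] := bc; have mj := kernel_mono kc.
have [b' jb'] : exists b', j \c b' = b.
  have [Q [q [[qb _] [_ Hj]]]] := jb.
  by have [b' [? _]] := Hj _ _ qb; exists b'.
have eb' := image_epi jb jb'.
have cb' : is_cokernel b' a.
  apply: epi_cokernel_kernel => //; apply: exact_mono_kernel => //.
  have [K [k [ka [bk Hk]]]] := ab; exists K, k; split=> //; split.
    by apply: mj; rewrite compA jb' bk compm0.
  by move=> W t bt; apply: Hk; rewrite -jb' -compA bt compm0.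
have [U [nu [nu' [nuK nu'K]]]] := h_surj u.
have [V [nv [nv' [nvK nv'K]]]] := h_surj v.
have [X0 [x0 [x0' [x0K x0'K]]]] := h_surj x.
have [X [sX isX]] := equivalence_surj (ae_equiv (shift T)) X0.
have [xi [xi' [xi'K xiK]]] : isomorphic x (s (h X)).
  have [al' [al'K alK]] := al_iso X.
  apply: isomorphic_sym; exists (x0 \c fmap h sX \c al').
  apply: isom_comp; last by exists (al X).
  by apply: isom_comp (fmap_isom h isX); exists x0'.
have ixi : isom xi by exists xi'.
have [g hg] := h_full (nv' \c a \c nu).
have mg : mono (fmap h g).
  rewrite hg; apply: mono_comp; last by apply: isom_mono; exists nu'.
  by apply: mono_comp ma; apply: isom_mono; exists nv.
have [K [be [d D]]] := dist_cone g.
have [d0 cbe] := triangle_mono_cokernel D mg.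
have cb2 : is_cokernel (b' \c nv) (fmap h g).
  rewrite hg -[b']comp1m; apply: cokernel_isom cb' => //; last exact: isom_idm.
  by apply: isom_epi; exists nu'.
have [ka [ika kab]] := cokernel_unique cbe cb2.
have /short_exactP S :=
  short_exact_isom ika ixi kc (epi_cokernel_kernel ec kc).
have [W Ww] := h_surj w.
have [f [f0 fe]] := cone_ext_surj (e := Extension S) Ww.
(* Both [f] and [d] are killed by [h], so [f] lifts by the square zero property. *)
have df : d \c f = 0 by apply: ker_ideal_square_zero; apply/eqP.
have [r rf] := dist_lift D df.
(* The homology of the lift [r] lands in [h U = ker (h be)], which allows to
   correct [r] by a map through [U]. *)
have [_ Kg] := mono_kernel_cokernel mg cbe.
have [|k [hk _]] := Kg _ (fmap h r); first by rewrite -fmapM rf f0.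
have [k' hk'] := h_full k.
pose r' := r - g \c k'.
have r'0 : fmap h r' = 0.
  by rewrite homologyD homologyN fmapM hk' hk subrr.
have r'f : be \c r' = f by rewrite compBr rf compA (dist_comp0 D) comp0m subr0.
have [e' r'e'] := cone_ext_exists r'0.
have := cone_ext_mor (u := idm X) (v := be) r'0 r'e' fe.
rewrite compm1 !fmap1 => /(_ r'f)[m /= [mi pm]].
have invv : isom nv' by exists nv.
have ixi' : isom xi' by exists xi.
have [ki' cp'] := (short_exactP _ _).1 (ext_exact e').
have /short_exactP S' := short_exact_isom invv ixi' ki' cp'.
exists (ext_mid e'), (ext_inj e' \c nv'), (xi' \c ext_proj e'), m; split=> //.
  by rewrite compA mi -(compA j) kab -!compA nv'K compm1.
by rewrite -[ext_proj e']comp1m -pm !compA xi'K comp1m.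
Qed.

(** If [h e] splits through [h Y], lifting the splitting gives an idempotent
    [e'] of [X], split by [Y], with [h e' = h e]. Then
    [u := e' e + (1 - e')(1 - e)] has [h u = 1] and [u e = e' u], so it is an
    automorphism conjugating [e] into [e']. *)
Lemma idempotents_split_of_realizes : realizes_objects h -> idempotents_split T.
Proof.
move=> h_surj X e ee.
have hee : fmap h e \c fmap h e = fmap h e by rewrite -fmapM ee.
have [y [i [p [pi ip]]]] := abelian_idempotents_split hee.
have [Y [m [n [nm mn]]]] := h_surj y.
have [i0 hi0] := h_full (i \c m); have [p' hp'] := h_full (n \c p).
(* The composite [p' i0] is the identity only in homology; [k] corrects this. *)
have /h_refl[k [kpi _]] : isom (fmap h (p' \c i0)).
  suff -> : fmap h (p' \c i0) = idm _ by exact: isom_idm.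
  by rewrite fmapM hi0 hp' -compA (compA p) pi comp1m.
have hk : fmap h k = idm _.
  have := congr1 (fmap h) kpi.
  rewrite !fmapM fmap1 hi0 hp' -(compA n) (compA p) pi comp1m nm.
  by rewrite compm1.
(* Opaque names keep the associativity rewrites from unfolding [q] and [e']. *)
have [q qE] : exists q, q = k \c p' by exists (k \c p').
have qi : q \c i0 = idm Y by rewrite qE -compA.
have [e' e'E] : exists e', e' = i0 \c q by exists (i0 \c q).
have he' : fmap h e' = fmap h e.
  rewrite e'E qE !fmapM hk comp1m hi0 hp' -ip.
  by rewrite -compA (compA m) mn comp1m.
have e'e' : e' \c e' = e' by rewrite e'E compA -(compA i0) qi compm1.
pose u := e' \c e + (idm X - e') \c (idm X - e).
have ue : u \c e = e' \c u.
  have -> : u \c e = e' \c e.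
    by rewrite compDl -!compA (compBl (idm X) e) comp1m ee subrr compm0 addr0.
  by rewrite /u compDr !compA (compBr e' (idm X)) compm1 e'e' subrr comp0m addr0.
have /h_refl[u' [u'u uu']] : isom (fmap h u).
  suff -> : fmap h u = idm _ by exact: isom_idm.
  rewrite homologyD !fmapM !homologyD !homologyN fmap1 he'.
  by rewrite hee compBr compm1 compBl comp1m hee subrr subr0 addrC subrK.
exists Y, (u' \c i0), (q \c u); split.
  by rewrite compA -(compA q) uu' compm1.
rewrite compA -(compA u') -e'E -compA -ue compA u'u.
by rewrite comp1m.
Qed.

End FullHomologyTheory.

Theorem theorem1 (T : triangulated) (A : abelian) (s : auto_equivalence A)
    (E : ext_sets A) (h : homology_theory T s)
    (h_refl : reflects_isos h) (h_full : full h) :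
  [/\ square_zero (ker_ideal h),
      realizes_extensions h ->
        exists theta : bifunctor_iso (Ext_bifunctor E (comp_functor s h) h)
                                     (ideal_bifunctor (ker_ideal h)),
        forall X Y : T,
          ab_short_exact
            (val \o theta X Y : {additive E (s (h X)) (h Y) -> hom X Y})
            (fmap h : {additive hom X Y -> hom (h X) (h Y)})
    & realizes_objects h -> hereditary A /\ idempotents_split T].
Proof.
have [al [al_iso al_nat]] := hom_shift h.
split.
- exact: (ker_ideal_square_zero al_iso al_nat h_refl h_full).
- move=> h_ext.
  pose theta := ext_ker_iso al_iso al_nat h_refl h_full E h_ext.
  exists theta => X Y; have [g thetaK gK] := biso_bij theta X Y; split.
  + by move=> c d e; apply: (can_inj thetaK); apply: val_inj.
  + move=> f; split=> [f0|[c <-]]; last exact/eqP/(valP (theta X Y c)).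
    have fI : f \in ker_ideal h X Y by apply/eqP.
    by exists (g (exist _ f fI)); rewrite /= gK.
  + exact: h_full.
- move=> h_surj; split.
    exact: (hereditary_of_realizes al_iso al_nat h_refl h_full h_surj).
  exact: (idempotents_split_of_realizes h_refl h_full h_surj).
Qed.
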